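(* Let $\kappa\in\mathbb{R}$ and let $(X,d)$ be a proper geodesic metric space of curvature $\le\kappa$. If the injectivity radius satisfies $\iota_X\le D_\kappa$, then $$\iota_X\le m_X.$$
   Context: **Geodesics.** A geodesic in a metric space $(X,d)$ is a map $\gamma\colon[0,c]\to X$ ($c\ge 0$) with $d(\gamma(s),\gamma(t))=|s-t|$ for all $s,t\in[0,c]$; it connects $\gamma(0)$ and $\gamma(c)$. $X$ is geodesic if every pair of points is connected by a geodesic, and proper if all closed balls are compact. **$\mathrm{CAT}(\kappa)$ and curvature $\le\kappa$.** Put $D_\kappa=\pi/\sqrt{\kappa}$ if $\kappa>0$ and $D_\kappa=+\infty$ if $\kappa\le 0$. Let $S_\kappa$ be the complete simply connected surface of constant curvature $\kappa$. A geodesic triangle $\Delta_{abc}$ in $X$ is a union $[a,b]\cup[b,c]\cup[c,a]$ of geodesics connecting three points pairwise. It is $\kappa$-small if $d(a,b)+d(b,c)+d(c,a)<2D_\kappa$. Its comparison triangle $\tilde\Delta_{abc}\subset S_\kappa$ is the geodesic triangle (unique up to congruence) with the same side lengths. The comparison point of $s\in[a,b]$ is the point $\tilde s\in[\tilde a,\tilde b]$ with $d(\tilde a,\tilde s)=d(a,s)$; similarly for the other sides. A metric space is $\mathrm{CAT}(\kappa)$ if for every $\kappa$-small geodesic triangle $\Delta_{abc}$ in it and all $s,t\in\Delta_{abc}$ with comparison points $\tilde s,\tilde t$ one has $d(s,t)\le d_{S_\kappa}(\tilde s,\tilde t)$. $X$ is of curvature $\le\kappa$ if each $x\in X$ admits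 $r_x>0$ such that the ball $B(x,r_x)$ with the induced metric is $\mathrm{CAT}(\kappa)$. **Injectivity radius.** $\iota_X$ is the supremum of the $r\ge 0$ such that any two points of $X$ at distance $<r$ are connected by a unique geodesic. **$m_X$.** A 4-cut in $X$ is a quadruple $(x_0,x_1,x_2,x_3)\in X^4$ such that $x_i\ne x_{i+1}$ for $0\le i\le 2$; $d(x_i,x_{i+2})=d(x_i,x_{i+1})+d(x_{i+1},x_{i+2})$ for $i=0,1$; and $d(x_0,x_3)<\sum_{j=0}^{2}d(x_j,x_{j+1})$. Its length is $\sum_{j=0}^{2}d(x_j,x_{j+1})$. $m_X$ is the infimum of the lengths of 4-cuts in $X$ (with $\inf\emptyset=+\infty$). *)

(* Defs.v *)
From HB Require Import structures.
From mathcomp Require Import all_boot all_order all_algebra.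
From mathcomp Require Import all_classical all_reals all_analysis.

Set Implicit Arguments.
Unset Strict Implicit.
Unset Printing Implicit Defensive.
Import Order.TTheory GRing.Theory Num.Theory.
Import numFieldNormedType.Exports.

Local Open Scope classical_set_scope.
Local Open Scope ring_scope.

(* The notions of this section are relative to a distance [d] on [T] restricted
   to a subset [A]: [A] with the induced metric is the metric space considered.
   This covers whole spaces, balls, and the surfaces of constant curvature,
   which are subsets of 'rV_3. *)
Section Geodesics.
Context {R : realType} {T : Type} (d : T -> T -> R) (A : set T).

(* Only the values of [g] on [0, c] matter. *)
Definition is_geodesic (c : R) (g : R -> T) : Prop :=
  [/\ 0 <= c,
      forall s, 0 <= s <= c -> A (g s) &
      forall s t, 0 <= s <= c -> 0 <= t <= c -> d (g s) (g t) = `|s - t|].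

(* The length of a geodesic from [x] to [y] is necessarily [d x y]. *)
Definition geodesic_from_to (x y : T) (g : R -> T) : Prop :=
  [/\ is_geodesic (d x y) g, g 0 = x & g (d x y) = y].

Definition segment (x y : T) (g : R -> T) : set T :=
  [set g t | t in [set t : R | 0 <= t <= d x y]].

(* Vertices [v i] and sides [g i] from [v i] to [v (i + 1)]; the addition of
   'I_3 is cyclic. *)
Definition geodesic_triangle (v : 'I_3 -> T) (g : 'I_3 -> R -> T) : Prop :=
  forall i, geodesic_from_to (v i) (v (i + 1)) (g i).

Definition perimeter (v : 'I_3 -> T) : R := \sum_i d (v i) (v (i + 1)).

End Geodesics.

Section ModelSurface.
Context {R : realType}.
Implicit Types (kappa : R) (u v : 'rV[R]_3).

Definition diameter_bound kappa : \bar R :=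
  if 0 < kappa then (pi / Num.sqrt kappa)%:E else +oo%E.

Definition arcosh (x : R) : R := ln (x + Num.sqrt (x ^+ 2 - 1)).

Definition euclidean_form u v : R :=
  u 0 0 * v 0 0 + u 0 1 * v 0 1 + u 0 2 * v 0 2.

Definition lorentz_form u v : R :=
  u 0 0 * v 0 0 - u 0 1 * v 0 1 - u 0 2 * v 0 2.

(* The complete simply connected surface of constant curvature [kappa]: the unit
   sphere with its angular distance divided by sqrt kappa, the upper sheet of
   the unit hyperboloid with its hyperbolic distance divided by
   sqrt (- kappa), or the Euclidean plane. *)
Definition model_surface kappa : set 'rV[R]_3 :=
  if 0 < kappa then [set u | euclidean_form u u = 1]
  else if kappa < 0 then [set u | lorentz_form u u = 1 /\ 0 < u 0 0]
  else [set u | u 0 0 = 0].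

Definition model_dist kappa u v : R :=
  if 0 < kappa then acos (euclidean_form u v) / Num.sqrt kappa
  else if kappa < 0 then arcosh (lorentz_form u v) / Num.sqrt (- kappa)
  else Num.sqrt (euclidean_form (u - v) (u - v)).

End ModelSurface.

Section Comparison.
Context {R : realType} (kappa : R) {T : Type} (d : T -> T -> R) (A : set T).

Let dk := model_dist kappa.

Definition comparison_triangle (v : 'I_3 -> T)
    (v' : 'I_3 -> 'rV[R]_3) (g' : 'I_3 -> R -> 'rV[R]_3) : Prop :=
  geodesic_triangle dk (model_surface kappa) v' g' /\
  forall i, dk (v' i) (v' (i + 1)) = d (v i) (v (i + 1)).

(* A point lying on several sides may have several comparison points. *)
Definition comparison_point (v : 'I_3 -> T) (g : 'I_3 -> R -> T)
    (v' : 'I_3 -> 'rV[R]_3) (g' : 'I_3 -> R -> 'rV[R]_3)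
    (s : T) (s' : 'rV[R]_3) : Prop :=
  exists i, [/\ segment d (v i) (v (i + 1)) (g i) s,
                segment dk (v' i) (v' (i + 1)) (g' i) s' &
                dk (v' i) s' = d (v i) s].

Definition is_CAT : Prop :=
  forall v g, geodesic_triangle d A v g ->
  ((perimeter d v)%:E < 2%:E * diameter_bound kappa)%E ->
  forall v' g', comparison_triangle v v' g' ->
  forall s t s' t', comparison_point v g v' g' s s' ->
                    comparison_point v g v' g' t t' ->
  d s t <= dk s' t'.

End Comparison.

Section MetricSpace.
Context {R : realType} (X : metricType R).

Local Notation dX := (@mdist R X).

Definition is_proper : Prop :=
  forall (x : X) (r : R), compact [set y | dX x y <= r].

Definition is_geodesic_space : Prop :=
  forall x y : X, exists g, geodesic_from_to dX setT x y g.

Definition curvature_le (kappa : R) : Prop :=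
  forall x : X, exists2 r : R, 0 < r & is_CAT kappa dX (ball x r).

Definition uniquely_joined (x y : X) : Prop :=
  exists2 g, geodesic_from_to dX setT x y g &
  forall g', geodesic_from_to dX setT x y g' ->
  forall t, 0 <= t <= dX x y -> g' t = g t.

Definition injectivity_radius : \bar R :=
  ereal_sup [set r%:E | r in [set r : R | 0 <= r /\
    forall x y : X, dX x y < r -> uniquely_joined x y]].

Definition length4 (x0 x1 x2 x3 : X) : R := dX x0 x1 + dX x1 x2 + dX x2 x3.

Definition four_cut (x0 x1 x2 x3 : X) : Prop :=
  [/\ [/\ x0 <> x1, x1 <> x2 & x2 <> x3],
      dX x0 x2 = dX x0 x1 + dX x1 x2,
      dX x1 x3 = dX x1 x2 + dX x2 x3 &
      dX x0 x3 < length4 x0 x1 x2 x3].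

Definition min_cut_length : \bar R :=
  ereal_inf [set l | exists x0 x1 x2 x3 : X,
    four_cut x0 x1 x2 x3 /\ l = (length4 x0 x1 x2 x3)%:E].

End MetricSpace.

(* Main.v *)
Require Import Defs.
From mathcomp Require Import all_boot all_order all_algebra.
From mathcomp Require Import all_classical all_reals all_analysis.
From mathcomp Require Import ring lra.

(** Suppose a 4-cut x0, x1, x2, x3 has length L smaller than the injectivity
    radius.  The geodesics x0 x2 and x1 x3 both contain the unique geodesic
    x1 x2, so they glue to a local geodesic gam of length L from x0 to x3
    ([glue_geodesics]).  As L is also smaller than pi / sqrt kappa
    (infinite if kappa <= 0), it suffices that local geodesics of such a length are geodesics
    ([local_geodesic_geodesic]); then d(x0, x3) = L, and the quadruple is not a
    4-cut.

    Let T be the largest time for which gam is a geodesic on [0, T], and suppose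
    T < L.  For t slightly larger than T put F = d(gam 0, gam t) and let beta
    be a geodesic of length F from gam t to gam 0.  Since X is proper and the
    geodesic from gam 0 to gam T is unique, beta stays close to gam run backwards
    from gam t ([near_between], [near_geodesic]).  Cut [0, F] into N steps of
    length h and let g_k be the distance between the k-th points of the two
    curves.  Then
    - g_0 = 0;
    - g_N <= u, where u = t - F, because gam is 1-Lipschitz;
    - u <= g_1: the point of gam at time t - h <= T is at distance t - h from
      gam 0, and the first point of beta is at distance F - h.
    On the other hand two nearby geodesics of a CAT(kappa) space satisfy a
    discrete Jacobi inequality: for G = chord g and an angle theta slightly
    larger than h sqrt kappa, 2 cos(theta) G_k <= G_(k-1) + G_(k+1)
    ([CAT_quadrilateral]).  Sturm comparison ([discrete_sturm]) then gives
    G_1 sin(N theta) <= G_N sin(theta).  The bound T sqrt kappa < pi leaves room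
    for theta = pi / (N + 2), for which sin(theta) < sin(N theta); hence u = 0
    ([chord_contraction_le0]) and gam is a geodesic beyond T, a contradiction
    ([extend_geodesic]).

    The Jacobi inequality comes from comparison triangles.  With sides a, b, c in
    curvature 1, the midpoints of the sides a and b are at distance e with
    cos e = (C^2 + S D) / (S + D), where C = cos(c/2), S = cos((a+b)/2) and
    D = cos((a-b)/2); in curvature -1 the formula is the same with cosh.  As S <=
    C <= D on the sphere, and D <= C <= S in the hyperbolic plane, this gives
    sin(e/2) <= sin(c/2) / (2 cos(theta)) in the former, for a and b at most
    2 theta, and e <= c / 2 in the latter. *)

Set Implicit Arguments.
Unset Strict Implicit.
Unset Printing Implicit Defensive.
Import Order.TTheory GRing.Theory Num.Theory.
Import numFieldNormedType.Exports.

Local Open Scope classical_set_scope.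
Local Open Scope ring_scope.

(** * Triangles in the curved model surfaces *)

Definition tri (T : Type) (p q r : T) (i : 'I_3) : T :=
  match val i with 0%N => p | 1%N => q | _ => r end.

Lemma ord3_ind (P : 'I_3 -> Prop) : P 0 -> P 1 -> P 2 -> forall i, P i.
Proof.
move=> P0 P1 P2 [[|[|[|//]]] ilt].
- by rewrite (_ : Ordinal ilt = 0) //; apply: val_inj.
- by rewrite (_ : Ordinal ilt = 1) //; apply: val_inj.
- by rewrite (_ : Ordinal ilt = 2) //; apply: val_inj.
Qed.

Definition vec3 (R : realType) (x y z : R) : 'rV[R]_3 := \row_i tri x y z i.

(** The sphere and the hyperboloid are treated together: eps is 1 or -1, and cs
    and sn are cos and sin, or cosh and sinh. *)
Section CurvedForm.
Context {R : realType} (eps : R) (cs sn : R -> R).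
Hypothesis eps2 : eps * eps = 1.
Hypothesis cs0 : cs 0 = 1.
Hypothesis sn0 : sn 0 = 0.
Hypothesis csB : forall x y, cs (x - y) = cs x * cs y + eps * (sn x * sn y).
Hypothesis snB : forall x y, sn (x - y) = sn x * cs y - cs x * sn y.
Implicit Types (p q r u v : 'rV[R]_3).

Definition sform u v : R := u 0 0 * v 0 0 + eps * (u 0 1 * v 0 1 + u 0 2 * v 0 2).

(** The arc of length l from p to q, as a combination of its end points; no
    tangent vector has to be chosen. *)
Definition arc (l : R) p q (x : R) : 'rV[R]_3 :=
  (sn (l - x) / sn l) *: p + (sn x / sn l) *: q.

Lemma csn2 x : cs x ^+ 2 + eps * sn x ^+ 2 = 1.
Proof. by rewrite -cs0 -(subrr x) csB !expr2. Qed.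

Lemma csN x : cs (- x) = cs x.
Proof. by rewrite -[- x]add0r csB cs0 sn0 mul0r mulr0 mul1r addr0. Qed.

Lemma snN x : sn (- x) = - sn x.
Proof. by rewrite -[- x]add0r snB cs0 sn0 mul0r mul1r add0r. Qed.

Lemma csD x y : cs (x + y) = cs x * cs y - eps * (sn x * sn y).
Proof. by rewrite -{1}[y]opprK csB csN snN mulrN mulrN. Qed.

Lemma snD x y : sn (x + y) = sn x * cs y + cs x * sn y.
Proof. by rewrite -{1}[y]opprK snB csN snN mulrN opprK. Qed.

Lemma sformC u v : sform u v = sform v u.
Proof. by rewrite /sform; ring. Qed.

Lemma sformDZ a b p q v : sform (a *: p + b *: q) v = a * sform p v + b * sform q v.
Proof. by rewrite /sform !mxE; ring. Qed.

Lemma arc0 l p q : sn l != 0 -> arc l p q 0 = p.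
Proof. by move=> l0; rewrite /arc subr0 sn0 mul0r scale0r addr0 divff// scale1r. Qed.

Lemma arcl l p q : sn l != 0 -> arc l p q l = q.
Proof. by move=> l0; rewrite /arc subrr sn0 mul0r scale0r add0r divff// scale1r. Qed.

Lemma sform_arc l p q x y : sn l != 0 ->
  sform p p = 1 -> sform q q = 1 -> sform p q = cs l ->
  sform (arc l p q x) (arc l p q y) = cs (x - y).
Proof.
move=> l0 pp qq pq; rewrite /arc sformDZ ![sform _ (_ + _)]sformC !sformDZ.
rewrite [sform q p]sformC pp qq pq !snB csB.
have E := csn2 l.
have E1 : cs l ^+ 2 = 1 - eps * sn l ^+ 2 by rewrite -E; ring.
set S := sn l in l0 E1 *; set C := cs l in E1 *.
transitivity ((S ^+ 2 * (cs x * cs y) + (1 - C ^+ 2) * (sn x * sn y)) / S ^+ 2).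
  by field.
by rewrite E1; field.
Qed.

(** The midpoint of an arc of length l is (p + q) / (2 cs (l / 2)). *)
Lemma sform_mid l l' p q r : sn l != 0 -> sn l' != 0 ->
  cs (l / 2) != 0 -> cs (l' / 2) != 0 ->
  sform p p = 1 ->
  sform (arc l p q (l / 2)) (arc l' r p (l' / 2)) =
    (1 + sform p q + sform r p + sform q r) / (4 * (cs (l / 2) * cs (l' / 2))).
Proof.
move=> l0 l'0 c0 c'0 pp.
have E x : sn x = 2 * (sn (x / 2) * cs (x / 2)).
  by rewrite {1}(splitr x) snD; ring.
have Ex (x : R) : x - x / 2 = x / 2 by field.
rewrite /arc !Ex !sformDZ ![sform _ (_ + _)]sformC !sformDZ pp.
rewrite [sform r q]sformC.
move: l0 l'0; rewrite !(E l) !(E l') => l0 l'0.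
have s0 : sn (l / 2) != 0 by apply: contra_neq l0 => ->; rewrite mul0r mulr0.
have s'0 : sn (l' / 2) != 0 by apply: contra_neq l'0 => ->; rewrite mul0r mulr0.
by field; rewrite c0 c'0 s0 s'0.
Qed.

(** Unit vectors whose Gram matrix is given by the cosines of prescribed side
    lengths; the first two coordinates of the third vector are forced, and the
    last one is real by the triangle inequalities. *)

Definition gram_p : 'rV[R]_3 := vec3 1 0 0.
Definition gram_q (a : R) : 'rV[R]_3 := vec3 (cs a) (sn a) 0.
Definition gram_r (a b c : R) : 'rV[R]_3 :=
  let y := eps * (cs c - cs a * cs b) / sn a in
  vec3 (cs b) y (Num.sqrt (sn b ^+ 2 - y ^+ 2)).

Lemma sform_pp : sform gram_p gram_p = 1.
Proof. by rewrite /sform !mxE /tri /=; ring. Qed.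

Lemma sform_qq a : sform (gram_q a) (gram_q a) = 1.
Proof. by rewrite /sform !mxE /= -(csn2 a) /tri /=; ring. Qed.

Lemma sform_pq a : sform gram_p (gram_q a) = cs a.
Proof. by rewrite /sform !mxE /tri /=; ring. Qed.

Lemma sform_rp a b c : sform (gram_r a b c) gram_p = cs b.
Proof. by rewrite /sform !mxE /tri /=; ring. Qed.

Lemma sform_qr a b c : sn a != 0 -> sform (gram_q a) (gram_r a b c) = cs c.
Proof.
move=> a0; rewrite /sform !mxE /tri /=.
transitivity (cs a * cs b + (eps * eps) * (cs c - cs a * cs b)); first by field.
by rewrite eps2; ring.
Qed.

Lemma sform_rr a b c : sn a != 0 ->
  (cs c - cs a * cs b) ^+ 2 <= (sn a * sn b) ^+ 2 ->
  sform (gram_r a b c) (gram_r a b c) = 1.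
Proof.
move=> a0 h; rewrite /sform !mxE /tri /= -!expr2 sqr_sqrtr; last first.
  rewrite subr_ge0 !exprMn exprVn [eps ^+ 2]expr2 eps2 mul1r.
  by rewrite ler_pdivrMr ?exprn_even_gt0 //= [leRHS]mulrC -exprMn.
by rewrite -(csn2 b); ring.
Qed.

Section Triangle.
Variables a b c : R.
Hypotheses (a0 : sn a != 0) (b0 : sn b != 0) (c0 : sn c != 0).
Hypothesis habc : (cs c - cs a * cs b) ^+ 2 <= (sn a * sn b) ^+ 2.

Definition gram_v : 'I_3 -> 'rV[R]_3 := tri gram_p (gram_q a) (gram_r a b c).
Definition gram_l : 'I_3 -> R := tri a c b.
Definition gram_g (i : 'I_3) (x : R) : 'rV[R]_3 :=
  arc (gram_l i) (gram_v i) (gram_v (i + 1)) x.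

Lemma gram_l_neq0 i : sn (gram_l i) != 0.
Proof. by move: i; apply: ord3_ind. Qed.

Lemma sform_gram_v i : sform (gram_v i) (gram_v i) = 1.
Proof.
move: i; apply: ord3_ind; rewrite /gram_v /=; first exact: sform_pp.
- exact: sform_qq.
- exact: sform_rr.
Qed.

Lemma sform_gram_vS i : sform (gram_v i) (gram_v (i + 1)) = cs (gram_l i).
Proof.
move: i; apply: ord3_ind; rewrite /gram_v /=; first exact: sform_pq.
- exact: sform_qr.
- exact: sform_rp.
Qed.

Lemma gram_g0 i : gram_g i 0 = gram_v i.
Proof. by rewrite /gram_g arc0 ?gram_l_neq0. Qed.

Lemma gram_gl i : gram_g i (gram_l i) = gram_v (i + 1).
Proof. by rewrite /gram_g arcl ?gram_l_neq0. Qed.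

Lemma sform_gram_g i x y : sform (gram_g i x) (gram_g i y) = cs (x - y).
Proof. by apply: sform_arc; rewrite ?gram_l_neq0 ?sform_gram_v ?sform_gram_vS. Qed.

(** The half-angle formulas turn the Gram matrix into the cosines of c/2 and
    (a + b)/2 and (a - b)/2, which the triangle inequalities put in order. *)
Lemma sform_gram_mid : cs (a / 2) != 0 -> cs (b / 2) != 0 ->
  sform (gram_g 0 (a / 2)) (gram_g 2 (b / 2)) =
    (cs (c / 2) ^+ 2 + cs ((a + b) / 2) * cs ((a - b) / 2)) /
    (cs ((a + b) / 2) + cs ((a - b) / 2)).
Proof.
move=> ca cb; transitivity (sform (arc a (gram_v 0) (gram_v 1) (a / 2))
    (arc b (gram_v 2) (gram_v 0) (b / 2))); first by [].
rewrite sform_mid ?(sform_gram_v 0)//.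
rewrite (sform_gram_vS 0) (sform_gram_vS 1) (sform_gram_vS 2) /gram_l /tri /=.
have D x : cs x = 2 * cs (x / 2) ^+ 2 - 1.
  by rewrite {1}(splitr x) csD; have := csn2 (x / 2); rewrite !expr2; lra.
rewrite (D a) (D b) (D c) [(a + b) / 2]mulrDl [(a - b) / 2]mulrBl csD csB.
have Ea : eps * sn (a / 2) ^+ 2 = 1 - cs (a / 2) ^+ 2 by have := csn2 (a / 2); lra.
have Eb : eps * sn (b / 2) ^+ 2 = 1 - cs (b / 2) ^+ 2 by have := csn2 (b / 2); lra.
set x := cs (a / 2) in Ea ca *; set y := cs (b / 2) in Eb cb *.
set z := cs (c / 2).
have -> : (x * y - eps * (sn (a / 2) * sn (b / 2))) *
   (x * y + eps * (sn (a / 2) * sn (b / 2))) = x ^+ 2 + y ^+ 2 - 1.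
  transitivity (x ^+ 2 * y ^+ 2 - (eps * sn (a / 2) ^+ 2) * (eps * sn (b / 2) ^+ 2)).
    by ring.
  by rewrite Ea Eb; ring.
have -> : x * y - eps * (sn (a / 2) * sn (b / 2)) +
   (x * y + eps * (sn (a / 2) * sn (b / 2))) = 2 * (x * y) by ring.
by field; rewrite cb ca.
Qed.

End Triangle.
End CurvedForm.

(** * Comparison triangles and their midpoints *)

(** For positive curvature, half the Euclidean chord of an arc on the unit sphere.
    Up to the diameter it is increasing and subadditive like the length, and in
    terms of it the midpoint inequality has no error term. *)
Definition chord (R : realType) (kappa x : R) : R :=
  if 0 < kappa then sin (Num.sqrt kappa * x / 2) else x.

(** The sides are listed as 0-1, 1-2, 2-0, so that a and b issue from vertex 0.
    The bound by pi places the distance of the midpoints where [chord] is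
    increasing. *)
Definition has_comparison (R : realType) (kappa theta a b c : R) : Prop :=
  exists (v : 'I_3 -> 'rV[R]_3) (g : 'I_3 -> R -> 'rV[R]_3),
  [/\ geodesic_triangle (model_dist kappa) (model_surface kappa) v g,
      forall i, model_dist kappa (v i) (v (i + 1)) = tri a c b i,
      Num.sqrt kappa * model_dist kappa (g 0 (a / 2)) (g 2 (b / 2)) <= pi &
      2 * cos theta * chord kappa (model_dist kappa (g 0 (a / 2)) (g 2 (b / 2)))
        <= chord kappa c].

Lemma geodesic_triangle_by_lengths (R : realType) (T : Type) (d : T -> T -> R)
    (A : set T) (l : 'I_3 -> R) (v : 'I_3 -> T) (g : 'I_3 -> R -> T) :
  (forall i, 0 <= l i) ->
  (forall i x, 0 <= x <= l i -> A (g i x)) ->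
  (forall i x y, 0 <= x <= l i -> 0 <= y <= l i -> d (g i x) (g i y) = `|x - y|) ->
  (forall i, g i 0 = v i) -> (forall i, g i (l i) = v (i + 1)) ->
  geodesic_triangle d A v g /\ forall i, d (v i) (v (i + 1)) = l i.
Proof.
move=> l0 gA gd g0 gl.
have dl i : d (v i) (v (i + 1)) = l i.
  by rewrite -g0 -gl gd ?lexx ?l0// sub0r normrN ger0_norm.
split=> // i; split; rewrite ?dl//.
by split=> // [s|s t]; [exact: gA|exact: gd].
Qed.

Lemma le_cos (R : realType) (x y : R) : 0 <= x -> x <= y -> y <= pi -> cos y <= cos x.
Proof.
move=> x0 xy ypi; have [->//|ne] := eqVneq x y.
by rewrite ltW// ltr_cos ?in_itv/= ?lt_neqAle ?ne// ?x0 ?(le_trans xy)// (le_trans x0).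
Qed.

(** Here S + D - (c^2 + S D) = (1 - c^2) - (1 - S)(1 - D) <= 1 - c^2. *)
Lemma midpoint_ratio_sphere (R : realFieldType) (S D c t : R) : 0 < S -> S <= c -> c <= D -> D <= 1 ->
  2 * t ^+ 2 <= S + D ->
  let E := (c ^+ 2 + S * D) / (S + D) in
  -1 <= E <= 1 /\ 2 * t ^+ 2 * (1 - E) <= 1 - c ^+ 2.
Proof.
move=> S0 Sc cD D1 tSD E.
have SD0 : 0 < S + D by lra.
have ESD : E * (S + D) = c ^+ 2 + S * D by rewrite /E divfK// lt0r_neq0.
have E1 : E <= 1.
  rewrite -(ler_pM2r SD0) ESD; nra.
split.
  rewrite E1 andbT -(ler_pM2r SD0) ESD; nra.
apply: (@le_trans _ _ ((S + D) * (1 - E))).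
  by rewrite ler_wpM2r// subr_ge0.
rewrite mulrBr mulr1 [_ * E]mulrC ESD; nra.
Qed.

(** The distance f of the midpoints enters through cos f = 1 - 2 sin(f/2)^2, and
    the denominator is 2 cos(a/2) cos(b/2) >= 2 cos(theta)^2. *)
Lemma sphere_midpoint_le (R : realType) (theta a b c : R) :
  0 < a <= 2 * theta -> 0 < b <= 2 * theta -> 0 < c -> theta < pi / 4 ->
  a <= b + c -> b <= a + c -> c <= a + b ->
  let f := acos ((cos (c / 2) ^+ 2 + cos ((a + b) / 2) * cos ((a - b) / 2)) /
                 (cos ((a + b) / 2) + cos ((a - b) / 2))) in
  f <= pi /\ 2 * cos theta * sin (f / 2) <= sin (c / 2).
Proof.
move=> /andP[a0 at2] /andP[b0 bt2] c0 th abc bac cab.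
have pi0 := pi_gt0 R.
have cA : cos theta <= cos (a / 2) by apply: le_cos; lra.
have cB : cos theta <= cos (b / 2) by apply: le_cos; lra.
have ct : 0 < cos theta by apply: cos_gt0_pihalf; lra.
have S0 : 0 < cos ((a + b) / 2) by apply: cos_gt0_pihalf; lra.
have SC : cos ((a + b) / 2) <= cos (c / 2) by apply: le_cos; lra.
have CD : cos (c / 2) <= cos ((a - b) / 2).
  rewrite -(cos_norm ((a - b) / 2)); apply: le_cos => //; last lra.
  by rewrite ler_norml; lra.
have sc0 : 0 <= sin (c / 2) by apply: sin_ge0_pi; lra.
have SD : 2 * cos theta ^+ 2 <= cos ((a + b) / 2) + cos ((a - b) / 2).
  rewrite [(a + b) / 2]mulrDl [(a - b) / 2]mulrBl cosD cosB expr2.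
  have : cos theta * cos theta <= cos (a / 2) * cos (b / 2).
    by apply: ler_pM => //; exact: ltW.
  by move=> ?; lra.
have [] := midpoint_ratio_sphere S0 SC CD (cos_le1 _) SD.
move=> EE hE /=; move: EE hE; set E := (_ / _) => EE hE.
have [/andP[f0 fpi] cosE] := acos_def EE.
move: f0 fpi cosE; set f := acos E => f0 fpi cosE; split=> //.
have sf0 : 0 <= sin (f / 2) by apply: sin_ge0_pi; lra.
rewrite -(@ler_pXn2r _ 2)// ?nnegrE//; last first.
  by apply: mulr_ge0 => //; apply: mulr_ge0 => //; exact: ltW.
have s2E : 2 * sin (f / 2) ^+ 2 = 1 - E.
  by rewrite -cosE {2}(splitr f) cosD -!expr2 cos2sin2; ring.
rewrite !exprMn [sin (c / 2) ^+ 2]sin2cos2; apply: le_trans hE.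
by rewrite -s2E le_eqVlt; apply/orP; left; apply/eqP; ring.
Qed.

Lemma sphere_comparison (R : realType) (kappa theta a b c : R) : 0 < kappa ->
  0 < a -> 0 < b -> 0 < c -> a <= b + c -> b <= a + c -> c <= a + b ->
  theta < pi / 4 -> Num.sqrt kappa * a <= 2 * theta -> Num.sqrt kappa * b <= 2 * theta ->
  has_comparison kappa theta a b c.
Proof.
move=> k0 a0 b0 c0 abc bac cab th wa wb.
set w := Num.sqrt kappa in wa wb *.
have w0 : 0 < w by rewrite sqrtr_gt0.
have pi0 := pi_gt0 R.
set A := w * a in wa *; set B := w * b in wb *; set C := w * c.
have A0 : 0 < A by rewrite mulr_gt0.
have B0 : 0 < B by rewrite mulr_gt0.
have C0 : 0 < C by rewrite mulr_gt0.
have ABC : A <= B + C by rewrite -mulrDr ler_pM2l.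
have BAC : B <= A + C by rewrite -mulrDr ler_pM2l.
have CAB : C <= A + B by rewrite -mulrDr ler_pM2l.
have sA : 0 < sin A by rewrite sin_gt0_pi// A0; lra.
have sB : 0 < sin B by rewrite sin_gt0_pi// B0; lra.
have sC : 0 < sin C by rewrite sin_gt0_pi// C0; lra.
have h1 : cos (A + B) <= cos C by apply: le_cos; lra.
have h2 : cos C <= cos (A - B).
  rewrite -(cos_norm (A - B)); apply: le_cos => //; last lra.
  by rewrite ler_norml; lra.
have sAB : 0 <= sin A * sin B by rewrite mulr_ge0// ltW.
have gram : (cos C - cos A * cos B) ^+ 2 <= (sin A * sin B) ^+ 2.
  rewrite -subr_ge0 subr_sqr; move: h1 h2; rewrite cosD cosB => h1 h2.
  by apply: mulr_ge0; lra.
have csB x y : cos (x - y) = cos x * cos y + 1 * (sin x * sin y) :> R.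
  by rewrite mul1r cosB.
pose v := gram_v 1 cos sin A B C.
pose g i x := gram_g 1 cos sin A B C i (w * x).
have lE i : gram_l A B C i = w * tri a c b i by move: i; apply: ord3_ind.
have wl i : 0 < w * tri a c b i < pi.
  by move: i; apply: ord3_ind; rewrite /tri /= -?/A -?/B -?/C; lra.
have formE p q : euclidean_form p q = sform 1 p q.
  by rewrite /euclidean_form /sform; ring.
have dE p q : model_dist kappa p q = acos (sform 1 p q) / w.
  by rewrite /model_dist k0 formE.
have gE i x y : sform 1 (g i x) (g i y) = cos (w * x - w * y).
  by rewrite sform_gram_g ?lt0r_neq0 ?mul1r ?cos0 ?sin0//; exact: sinB.
have [gT dT] : geodesic_triangle (model_dist kappa) (model_surface kappa) v g /\
    forall i, model_dist kappa (v i) (v (i + 1)) = tri a c b i.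
  apply: geodesic_triangle_by_lengths.
  - by apply: ord3_ind; rewrite /tri /= ltW.
  - by move=> i x _; rewrite /model_surface k0 /= formE gE subrr cos0.
  - move=> i x y /andP[x0 xl] /andP[y0 yl]; rewrite dE gE -cos_norm cosK.
      by rewrite -mulrBr normrM gtr0_norm// mulrC mulrA mulVf ?mul1r// lt0r_neq0.
    rewrite in_itv /= normr_ge0 /= ler_norml; have /andP[_ wlp] := wl i.
    have : w * x <= w * tri a c b i by rewrite ler_pM2l.
    have : w * y <= w * tri a c b i by rewrite ler_pM2l.
    have : 0 <= w * x by rewrite mulr_ge0// ltW.
    have : 0 <= w * y by rewrite mulr_ge0// ltW.
    lra.
  - by move=> i; rewrite /g mulr0 gram_g0 ?lt0r_neq0 ?mul1r ?cos0 ?sin0.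
  - by move=> i; rewrite /g -lE gram_gl ?lt0r_neq0 ?mul1r ?cos0 ?sin0.
have cA : 0 < cos (A / 2) by apply: cos_gt0_pihalf; lra.
have cB : 0 < cos (B / 2) by apply: cos_gt0_pihalf; lra.
have E : sform 1 (g 0 (a / 2)) (g 2 (b / 2)) =
    (cos (C / 2) ^+ 2 + cos ((A + B) / 2) * cos ((A - B) / 2)) /
    (cos ((A + B) / 2) + cos ((A - B) / 2)).
  rewrite /g !mulrA sform_gram_mid ?mul1r ?lt0r_neq0 ?cos0 ?sin0//.
  exact: sinB.
have [fpi f2] : _ /\ _ := sphere_midpoint_le (introT andP (conj A0 wa))
  (introT andP (conj B0 wb)) C0 th ABC BAC CAB.
by exists v, g; split; rewrite // ?dE E /chord ?k0 -/w mulrCA divff ?lt0r_neq0// mulr1.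
Qed.

Section Hyperbolic.
Context {R : realType}.
Implicit Types x y : R.

Definition ch x : R := (expR x + expR (- x)) / 2.
Definition sh x : R := (expR x - expR (- x)) / 2.

Lemma ch0 : ch 0 = 1. Proof. by rewrite /ch oppr0 expR0; field. Qed.
Lemma sh0 : sh 0 = 0. Proof. by rewrite /sh oppr0 subrr mul0r. Qed.

Lemma chB x y : ch (x - y) = ch x * ch y + -1 * (sh x * sh y).
Proof. by rewrite /ch /sh opprB addrC !expRD; field. Qed.

Lemma shB x y : sh (x - y) = sh x * ch y - ch x * sh y.
Proof. by rewrite /ch /sh opprB ![expR (_ - _)]expRD; field. Qed.

Lemma sh_gt0 x : 0 < x -> 0 < sh x.
Proof. by move=> x0; rewrite divr_gt0// subr_gt0 ltr_expR; lra. Qed.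

Lemma sh_ge0 x : 0 <= x -> 0 <= sh x.
Proof. by rewrite le_eqVlt => /predU1P[<-|/sh_gt0/ltW//]; rewrite sh0. Qed.

Lemma ch_gt0 x : 0 < ch x.
Proof. by rewrite divr_gt0// addr_gt0// expR_gt0. Qed.

Lemma ch_norm x : ch `|x| = ch x.
Proof. by case: (leP 0 x) => [/ger0_norm->//|/ltr0_norm->]; rewrite /ch opprK addrC. Qed.

Lemma ler_ch x y : 0 <= x -> x <= y -> ch x <= ch y.
Proof.
move=> x0 xy; have -> : y = (x + y) / 2 - (x - y) / 2 by field.
have {1}-> : x = (x + y) / 2 - (y - x) / 2 by field.
have h : 0 <= sh ((x + y) / 2) * sh ((y - x) / 2).
  by rewrite mulr_ge0// sh_ge0//; lra.
have -> : (x - y) / 2 = 0 - (y - x) / 2 by field.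
by rewrite !chB shB ch0 sh0; lra.
Qed.

Lemma ch_arcosh x : 0 <= x -> arcosh (ch x) = x.
Proof.
move=> x0; have := csn2 ch0 chB x => E.
rewrite /arcosh (_ : ch x ^+ 2 - 1 = sh x ^+ 2); last lra.
rewrite sqrtr_sqr ger0_norm ?sh_ge0// (_ : ch x + sh x = expR x) ?expRK//.
by rewrite /ch /sh; field.
Qed.

Lemma ler_arcosh x y : 0 < x -> x <= y -> arcosh x <= arcosh y.
Proof.
move=> x0 xy; have y0 : 0 < y by lra.
rewrite /arcosh ler_ln ?posrE ?ltr_wpDr ?sqrtr_ge0// lerD// ler_wsqrtr//.
by rewrite lerB// ler_pXn2r// nnegrE ltW.
Qed.

(** The upper bound amounts to (c - S)(c - D) <= 0. *)
Lemma midpoint_ratio_hyperbolic (S D c : R) : 1 <= D -> D <= c -> c <= S ->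
  0 < (c ^+ 2 + S * D) / (S + D) <= c.
Proof.
move=> D1 Dc cS; have SD0 : 0 < S + D by lra.
rewrite divr_gt0//=; last by nra.
by rewrite ler_pdivrMr//; nra.
Qed.

Lemma hyperbolic_comparison (kappa theta a b c : R) : kappa < 0 -> 0 <= cos theta ->
  0 < a -> 0 < b -> 0 < c -> a <= b + c -> b <= a + c -> c <= a + b ->
  has_comparison kappa theta a b c.
Proof.
move=> k0 ct a0 b0 c0 abc bac cab.
have nk0 : (0 < kappa) = false by apply/negbTE; rewrite -leNgt ltW.
set w := Num.sqrt (- kappa).
have w0 : 0 < w by rewrite sqrtr_gt0 oppr_gt0.
set A := w * a; set B := w * b; set C := w * c.
have A0 : 0 < A by rewrite mulr_gt0.
have B0 : 0 < B by rewrite mulr_gt0.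
have C0 : 0 < C by rewrite mulr_gt0.
have ABC : A <= B + C by rewrite -mulrDr ler_pM2l.
have BAC : B <= A + C by rewrite -mulrDr ler_pM2l.
have CAB : C <= A + B by rewrite -mulrDr ler_pM2l.
have sA := sh_gt0 A0; have sB := sh_gt0 B0; have sC := sh_gt0 C0.
have h1 : ch C <= ch (A + B) by apply: ler_ch; lra.
have h2 : ch (A - B) <= ch C.
  by rewrite -(ch_norm (A - B)); apply: ler_ch => //; rewrite ler_norml; lra.
have N1 : -1 * -1 = 1 :> R by rewrite mulN1r opprK.
have gram : (ch C - ch A * ch B) ^+ 2 <= (sh A * sh B) ^+ 2.
  rewrite -subr_ge0 subr_sqr; move: h1 h2.
  rewrite (csD ch0 sh0 chB shB) chB => h1 h2.
  by apply: mulr_ge0; lra.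
pose v := gram_v (-1) ch sh A B C.
pose g i x := gram_g (-1) ch sh A B C i (w * x).
have lE i : gram_l A B C i = w * tri a c b i by move: i; apply: ord3_ind.
have l0 i : 0 < tri a c b i by move: i; apply: ord3_ind.
have formE p q : lorentz_form p q = sform (-1) p q.
  by rewrite /lorentz_form /sform; ring.
have dE p q : model_dist kappa p q = arcosh (sform (-1) p q) / w.
  by rewrite /model_dist nk0 k0 formE.
have gE i x y : sform (-1) (g i x) (g i y) = ch (w * x - w * y).
  by rewrite sform_gram_g ?lt0r_neq0 ?ch0 ?sh0//; [exact: chB|exact: shB].
have v0 i : 0 < v i 0 0.
  by move: i; apply: ord3_ind; rewrite /v /gram_v /tri /= !mxE /tri /= ?ch_gt0.
have g00 i x : 0 <= x <= tri a c b i -> 0 < g i x 0 0.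
  move=> /andP[x0 xl]; rewrite /g /gram_g /arc lE !mxE -mulrBr.
  have wl : 0 < sh (w * tri a c b i) by rewrite sh_gt0// mulr_gt0.
  have := x0; rewrite le_eqVlt => /predU1P[<-|x1].
    by rewrite subr0 mulr0 sh0 mul0r mul0r addr0 divff ?lt0r_neq0// mul1r.
  rewrite ltr_wpDl//.
    apply: mulr_ge0; last exact: ltW.
    apply: divr_ge0; last exact: ltW.
    by rewrite sh_ge0// mulr_ge0 ?subr_ge0// ltW.
  apply: mulr_gt0 => //; apply: divr_gt0 => //.
  by rewrite sh_gt0// mulr_gt0.
have [gT dT] : geodesic_triangle (model_dist kappa) (model_surface kappa) v g /\
    forall i, model_dist kappa (v i) (v (i + 1)) = tri a c b i.
  apply: geodesic_triangle_by_lengths.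
  - by move=> i; exact: ltW.
  - by move=> i x xl; rewrite /model_surface nk0 k0 /= formE gE subrr ch0 g00.
  - move=> i x y _ _; rewrite dE gE -ch_norm ch_arcosh//.
    by rewrite -mulrBr normrM gtr0_norm// mulrC mulrA mulVf ?mul1r// lt0r_neq0.
  - by move=> i; rewrite /g mulr0 gram_g0 ?lt0r_neq0 ?ch0 ?sh0.
  - by move=> i; rewrite /g -lE gram_gl ?lt0r_neq0 ?ch0 ?sh0.
exists v, g; split=> //.
  by rewrite ler0_sqrtr ?mul0r ?pi_ge0// ltW.
rewrite dE /chord nk0.
have -> : sform (-1) (g 0 (a / 2)) (g 2 (b / 2)) =
    sform (-1) (gram_g (-1) ch sh A B C 0 (A / 2)) (gram_g (-1) ch sh A B C 2 (B / 2)).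
  by rewrite /g !mulrA.
rewrite sform_gram_mid ?lt0r_neq0 ?ch0 ?sh0 ?ch_gt0//; try by [exact: chB|exact: shB].
have D1 : 1 <= ch ((A - B) / 2) by rewrite -ch0 -(ch_norm ((_ - _) / _)) ler_ch.
have DC : ch ((A - B) / 2) <= ch (C / 2).
  by rewrite -(ch_norm ((A - B) / 2)); apply: ler_ch => //; rewrite ler_norml; lra.
have CS : ch (C / 2) <= ch ((A + B) / 2) by apply: ler_ch; lra.
have /andP[E0 Ec] := midpoint_ratio_hyperbolic D1 DC CS.
have := ler_arcosh E0 Ec; rewrite ch_arcosh; last by rewrite divr_ge0// ltW.
set f := arcosh _ => fC.
have {}fC : f / w <= c / 2 by rewrite ler_pdivrMr// mulrC mulrA.
have := ler_wpM2l ct fC.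
have : cos theta * c <= 1 * c by rewrite ler_wpM2r ?cos_le1// ltW.
lra.
Qed.
End Hyperbolic.

(** In the plane the midpoints are at distance c / 2, by similarity. *)
Lemma flat_comparison (R : realType) (theta a b c : R) : 0 <= cos theta ->
  0 < a -> 0 < b -> 0 < c -> a <= b + c -> b <= a + c -> c <= a + b ->
  has_comparison 0 theta a b c.
Proof.
move=> ct a0 b0 c0 abc bac cab.
pose x := (a ^+ 2 + b ^+ 2 - c ^+ 2) / (2 * a).
pose y := Num.sqrt (b ^+ 2 - x ^+ 2).
have xE : 2 * a * x = a ^+ 2 + b ^+ 2 - c ^+ 2.
  by rewrite /x mulrC divfK// mulf_neq0// lt0r_neq0.
have yE : y ^+ 2 = b ^+ 2 - x ^+ 2.
  rewrite sqr_sqrtr// subr_sqr; apply: mulr_ge0; rewrite -(pmulr_rge0 _ (_ : 0 < 2 * a)) ?mulr_gt0//.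
    rewrite mulrBr xE.
    have -> : 2 * a * b - (a ^+ 2 + b ^+ 2 - c ^+ 2) = (c - (a - b)) * (c + (a - b)) by ring.
    by apply: mulr_ge0; lra.
  rewrite mulrDr xE.
  have -> : 2 * a * b + (a ^+ 2 + b ^+ 2 - c ^+ 2) = ((a + b) - c) * ((a + b) + c) by ring.
  by apply: mulr_ge0; lra.
pose l : 'I_3 -> R := tri a c b.
pose v : 'I_3 -> 'rV[R]_3 := tri (vec3 0 0 0) (vec3 0 a 0) (vec3 0 x y).
pose g i s : 'rV[R]_3 := (1 - s / l i) *: v i + (s / l i) *: v (i + 1).
have l0 i : 0 < l i by move: i; apply: ord3_ind.
have dE p q : model_dist 0 p q = Num.sqrt (euclidean_form (p - q) (p - q)) :> R.
  by rewrite /model_dist ltxx.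
have sides i : euclidean_form (v i - v (i + 1)) (v i - v (i + 1)) = l i ^+ 2.
  move: i; apply: ord3_ind; rewrite /euclidean_form /v /l /tri /= !mxE /tri /=; try ring.
  - transitivity (a ^+ 2 - 2 * a * x + x ^+ 2 + y ^+ 2); first ring.
    by rewrite xE yE; ring.
  - transitivity (x ^+ 2 + y ^+ 2); first ring.
    by rewrite yE; ring.
have [gT dT] : geodesic_triangle (model_dist 0) (model_surface 0) v g /\
    forall i, model_dist 0 (v i) (v (i + 1)) = l i.
  apply: geodesic_triangle_by_lengths.
  - by move=> i; exact: ltW.
  - move=> i s _; rewrite /model_surface ltxx /= /g !mxE.
    have v0 j : v j 0 0 = 0 by move: j; apply: ord3_ind; rewrite /v /tri /= mxE.
    by rewrite !v0 !mulr0 addr0.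
  - move=> i s t _ _; rewrite dE.
    have -> : g i s - g i t = ((t - s) / l i) *: (v i - v (i + 1)).
      apply/rowP => j; rewrite !mxE; ring.
    have -> k (p : 'rV[R]_3) : euclidean_form (k *: p) (k *: p) = k ^+ 2 * euclidean_form p p.
      by rewrite /euclidean_form !mxE; ring.
    by rewrite sides -exprMn divfK ?lt0r_neq0// sqrtr_sqr distrC.
  - by move=> i; rewrite /g mul0r subr0 scale1r scale0r addr0.
  - by move=> i; rewrite /g divff ?lt0r_neq0// subrr scale1r scale0r add0r.
exists v, g; split=> //.
  by rewrite sqrtr0 mul0r pi_ge0.
rewrite /chord ltxx dE.
have -> : euclidean_form (g 0 (a / 2) - g 2 (b / 2)) (g 0 (a / 2) - g 2 (b / 2)) =
   (c / 2) ^+ 2.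
  have ha : a / 2 / a = 1 / 2 by field; rewrite lt0r_neq0.
  have hb : b / 2 / b = 1 / 2 by field; rewrite lt0r_neq0.
  rewrite /g /l /tri /= ha hb /euclidean_form /v /tri /= !mxE /tri /=.
  transitivity ((a ^+ 2 - 2 * a * x + x ^+ 2 + y ^+ 2) / 4); first by field.
  by rewrite xE yE; field.
rewrite sqrtr_sqr ger0_norm; last lra.
have : cos theta * c <= 1 * c by rewrite ler_wpM2r ?cos_le1// ltW.
lra.
Qed.

Lemma model_comparison (R : realType) (kappa theta a b c : R) :
  0 < theta < pi / 4 ->
  0 < a -> 0 < b -> 0 < c -> a <= b + c -> b <= a + c -> c <= a + b ->
  Num.sqrt kappa * a <= 2 * theta -> Num.sqrt kappa * b <= 2 * theta ->
  has_comparison kappa theta a b c.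
Proof.
move=> /andP[th0 th] a0 b0 c0 abc bac cab wa wb.
have ct : 0 <= cos theta by apply: cos_ge0_pihalf; have := pi_gt0 R; lra.
have [k0|k0|<-] := ltrgtP 0 kappa; [exact: sphere_comparison|..].
- exact: hyperbolic_comparison.
- exact: flat_comparison.
Qed.

(** * Geodesics and the midpoint inequality *)

Section Chord.
Context {R : realType} (kappa : R).
Local Notation w := (Num.sqrt kappa).
Local Notation chord := (chord kappa).

Lemma chord0 : chord 0 = 0.
Proof. by rewrite /chord mulr0 mul0r sin0 if_same. Qed.

Lemma chord_ge0 x : 0 <= x -> w * x <= pi -> 0 <= chord x.
Proof.
move=> x0 xpi; rewrite /chord; case: ifP => // k0.
have wx : 0 <= w * x by rewrite mulr_ge0 ?sqrtr_ge0.
by rewrite sin_ge0_pi//; lra.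
Qed.

Lemma chord_gt0 x : 0 < x -> w * x <= pi -> 0 < chord x.
Proof.
move=> x0 xpi; rewrite /chord; case: ifP => // k0.
have wx : 0 < w * x by rewrite mulr_gt0 ?sqrtr_gt0.
by rewrite sin_gt0_pi//; have := pi_gt0 R; lra.
Qed.

Lemma ler_chord x y : 0 <= x -> x <= y -> w * y <= pi -> chord x <= chord y.
Proof.
move=> x0 xy ypi; rewrite /chord; case: ifP => // k0.
have [->//|ne] := eqVneq x y.
have wx : 0 <= w * x by rewrite mulr_ge0 ?sqrtr_ge0.
have wxy : w * x < w * y by rewrite ltr_pM2l ?sqrtr_gt0// lt_neqAle ne.
by rewrite ltW// ltr_sin ?in_itv/=; lra.
Qed.

Lemma chordD x y : 0 <= x -> 0 <= y -> w * x <= pi -> w * y <= pi ->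
  chord (x + y) <= chord x + chord y.
Proof.
move=> x0 y0 xpi ypi.
have := chord_ge0 x0 xpi; have := chord_ge0 y0 ypi.
rewrite /chord; case: ifP => // k0 sy sx.
rewrite mulrDr mulrDl sinD lerD//.
  by rewrite ler_piMr// cos_le1.
by rewrite ler_piMl// cos_le1.
Qed.

End Chord.

Section Metric.
Context {R : realType} (X : metricType R).
Local Notation dX := (@mdist R X).
Hypothesis hgeod : is_geodesic_space X.

(** A curve that is no longer than the distance of its end points cannot be
    shortened on any subinterval. *)
Lemma geodesic_of_lipschitz (x z : X) (g : R -> X) : g 0 = x -> g (dX x z) = z ->
  (forall s t, 0 <= s -> s <= t -> t <= dX x z -> dX (g s) (g t) <= t - s) ->
  geodesic_from_to dX setT x z g.
Proof.
move=> g0 g1 lip; split=> //; split=> //; first exact: mdist_ge0.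
have E s t : 0 <= s -> s <= t -> t <= dX x z -> dX (g s) (g t) = t - s.
  move=> s0 st tl; apply/eqP; rewrite eq_le lip//=.
  have := lip 0 s (lexx _) s0 (le_trans st tl).
  have := lip t (dX x z) (le_trans s0 st) tl (lexx _).
  rewrite g0 g1; have := metric_triangle x (g s) z.
  by have := metric_triangle (g s) (g t) z; lra.
move=> s t /andP[s0 sl] /andP[t0 tl]; have [st|ts] := leP s t.
  by rewrite E// ler0_norm ?subr_le0// opprB.
by rewrite metric_sym E ?(ltW ts)// gtr0_norm ?subr_gt0.
Qed.

Lemma geodesic_through (x y z : X) : dX x y + dX y z = dX x z ->
  exists2 g, geodesic_from_to dX setT x z g & g (dX x y) = y.
Proof.
move=> xyz; have [g [[_ _ gE] g0 gl]] := hgeod x y.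
have [h [[_ _ hE] h0 hl]] := hgeod y z.
have xy0 := mdist_ge0 x y; have yz0 := mdist_ge0 y z.
exists (fun s => if s <= dX x y then g s else h (s - dX x y)); last by rewrite lexx.
apply: geodesic_of_lipschitz.
- by rewrite xy0.
- case: ifPn => [le|_]; last by rewrite -{1}xyz addrAC subrr add0r.
  have yz : dX y z = 0 by lra.
  by rewrite -xyz yz addr0 gl; exact: mdist_positivity.
- move=> s t s0 st tl; have [tx|tx] := leP t (dX x y).
    by rewrite (le_trans st tx) gE ?s0 ?(le_trans st)// ?(le_trans s0)// distrC ger0_norm// subr_ge0.
  have [sx|sx] := leP s (dX x y).
    apply: le_trans (metric_triangle _ y _) _.
    have : dX (g s) (g (dX x y)) = `|s - dX x y| by rewrite gE ?s0 ?xy0 ?lexx.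
    have : dX (h 0) (h (t - dX x y)) = `|0 - (t - dX x y)| by rewrite hE; lra.
    rewrite gl h0 => -> ->.
    by rewrite sub0r normrN distrC !ger0_norm; lra.
  by rewrite hE; try lra; rewrite distrC ger0_norm//; lra.
Qed.

Lemma between_unique (x y y' z : X) : uniquely_joined x z ->
  dX x y + dX y z = dX x z -> dX x y' + dX y' z = dX x z -> dX x y' = dX x y ->
  y' = y.
Proof.
move=> [g _ gu] xyz xy'z e.
have [h hG hy] := geodesic_through xyz; have [h' hG' hy'] := geodesic_through xy'z.
have yl : 0 <= dX x y <= dX x z by rewrite mdist_ge0/= -xyz lerDl mdist_ge0.
by rewrite -hy -hy' e (gu _ hG)// (gu _ hG').
Qed.

Lemma triangle_perimeter (p q r : X) :
  perimeter dX (tri p q r) = dX p q + dX q r + dX r p.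
Proof. by rewrite /perimeter !big_ord_recl big_ord0 addr0 addrA. Qed.

Lemma geodesic_in_ball (y u v : X) (r : R) (g : R -> X) :
  dX y u < r / 4 -> dX y v < r / 4 -> geodesic_from_to dX setT u v g ->
  geodesic_from_to dX (ball y r) u v g.
Proof.
move=> yu yv [[l0 _ gE] g0 gl]; split=> //; split=> // s /andP[s0 sl].
rewrite ballEmdist /=; apply: le_lt_trans (metric_triangle _ u _) _.
rewrite -{2}g0 gE ?lexx ?s0//= sub0r normrN ger0_norm//.
have := metric_triangle u y v; rewrite (metric_sym u y); have := mdist_ge0 y u; lra.
Qed.

(** Points within r / 4 of the centre have all their geodesics in the ball, so the
    triangle p q q' is compared in the model, where [model_comparison] applies.
    Degenerate triangles with q = q' are settled by uniqueness of geodesics. *)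
Lemma CAT_midpoints (kappa theta r : R) (y p q q' m n : X) :
  is_CAT kappa dX (ball y r) -> 0 < theta < pi / 4 ->
  dX y p < r / 4 -> dX y q < r / 4 -> dX y q' < r / 4 ->
  0 < dX p q -> 0 < dX p q' -> uniquely_joined p q ->
  Num.sqrt kappa * dX p q <= 2 * theta -> Num.sqrt kappa * dX p q' <= 2 * theta ->
  dX p m = dX p q / 2 -> dX m q = dX p q / 2 ->
  dX p n = dX p q' / 2 -> dX n q' = dX p q' / 2 ->
  2 * cos theta * chord kappa (dX m n) <= chord kappa (dX q q').
Proof.
move=> cat th yp yq yq' pq0 pq'0 upq wq wq' pm mq pn nq'.
have [eq|ne] := eqVneq q q'.
  subst q'; rewrite (@between_unique p m n q)//; last by rewrite pn pm.
  - by rewrite !mdistxx !chord0 mulr0.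
  - by rewrite pm mq; lra.
  - by rewrite pn nq'; lra.
have qq'0 : 0 < dX q q' by rewrite mdist_gt0.
set a := dX p q in pq0 wq pm mq *; set c := dX q q' in qq'0 *.
have eb : dX q' p = dX p q' by exact: metric_sym.
have [v' [g' [gT dT epi emid]]] : has_comparison kappa theta a (dX q' p) c.
  apply: model_comparison; rewrite ?eb// /a /c.
  - by have := metric_triangle p q' q; rewrite (metric_sym q' q); lra.
  - by have := metric_triangle p q q'; lra.
  - by have := metric_triangle q p q'; rewrite (metric_sym q p); lra.
have [g1 G1 g1m] : exists2 g, geodesic_from_to dX setT p q g & g (a / 2) = m.
  by rewrite -pm; apply: geodesic_through; rewrite pm mq /a; lra.
have [g2 G2] := hgeod q q'.
have [g3 G3 g3n] : exists2 g, geodesic_from_to dX setT q' p g & g (dX q' p / 2) = n.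
  rewrite eb -nq' metric_sym; apply: geodesic_through.
  by rewrite (metric_sym q') (metric_sym n p) pn nq' eb; lra.
pose v := tri p q q'; pose g := tri g1 g2 g3.
have vT : geodesic_triangle dX (ball y r) v g.
  by apply: ord3_ind; exact: geodesic_in_ball.
have dv i : dX (v i) (v (i + 1)) = tri a c (dX q' p) i by move: i; apply: ord3_ind.
have per : ((perimeter dX v)%:E < 2%:E * diameter_bound kappa)%E.
  rewrite triangle_perimeter /diameter_bound; case: ifPn => k0; last first.
    by rewrite mulry gtr0_sg// mul1e ltry.
  rewrite -EFinM lte_fin mulrA ltr_pdivlMr ?sqrtr_gt0// mulrC.
  have h : dX q q' <= dX p q + dX p q'.
    by have := metric_triangle q p q'; rewrite (metric_sym q p).
  have := ler_wpM2l (sqrtr_ge0 kappa) h.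
  by move: th wq wq' => /andP[th0 th]; rewrite eb -/c -/a !(mulrDr (Num.sqrt kappa)); lra.
have cmp : comparison_triangle kappa dX v v' g'.
  by split=> // i; rewrite dT dv.
have cp (i : 'I_3) : comparison_point kappa dX v g v' g'
    (g i (tri a c (dX q' p) i / 2)) (g' i (tri a c (dX q' p) i / 2)).
  have h0 : 0 <= tri a c (dX q' p) i by rewrite -dv mdist_ge0.
  exists i; split.
  - by exists (tri a c (dX q' p) i / 2); rewrite //= dv; lra.
  - by exists (tri a c (dX q' p) i / 2); rewrite //= dT; lra.
  have [[_ _ gE'] g0' _] := gT i; have [[_ _ gE] g0 _] := vT i.
  by rewrite -{1}g0' gE' ?dT -?g0 ?gE ?dv //; lra.
have := cat v g vT per v' g' cmp _ _ _ _ (cp 0) (cp 2).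
rewrite /g /tri /= g1m g3n => mn.
apply: le_trans emid; rewrite ler_wpM2l//.
  by rewrite mulr_ge0// cos_ge0_pihalf//; have := pi_gt0 R; lra.
by apply: ler_chord => //; exact: mdist_ge0.
Qed.

End Metric.

(** * Sturm comparison *)

(** The discrete Wronskian G_(k+1) sin(k theta) - G_k sin((k+1) theta) vanishes at
    k = 0 and does not decrease, so that G_k / sin(k theta) does not decrease. *)
Lemma discrete_sturm (R : realType) (theta : R) (N : nat) (G : nat -> R) :
  0 < theta -> N%:R * theta < pi -> (0 < N)%N -> G 0%N = 0 ->
  (forall k, (k.+1 < N)%N -> 2 * cos theta * G k.+1 <= G k + G k.+2) ->
  G 1%N * sin (N%:R * theta) <= G N * sin theta.
Proof.
move=> th0 thN N0 G0 HG.
have S0 k : (0 < k <= N)%N -> 0 < sin (k%:R * theta).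
  move=> /andP[k0 kN]; rewrite sin_gt0_pi// mulr_gt0 ?ltr0n//=.
  by apply: le_lt_trans thN; rewrite ler_pM2r// ler_nat.
have step k : (k < N)%N ->
    G k * sin (k.+1%:R * theta) <= G k.+1 * sin (k%:R * theta).
  elim: k => [|k IH] kN; first by rewrite G0 mul0r mul0r sin0 mulr0.
  have {}IH := IH (ltnW kN).
  have s0 := S0 k.+1 (ltnW kN); have := ler_wpM2r (ltW s0) (HG k kN).
  have e1 : k.+2%:R * theta = k.+1%:R * theta + theta by rewrite -natr1 mulrDl mul1r.
  have e2 : k%:R * theta = k.+1%:R * theta - theta by rewrite -natr1 mulrDl mul1r addrK.
  move: IH; rewrite e1 e2 [sin (_ - theta)]sinB sinD; lra.
elim: N => [//|[|k] IH] in thN N0 HG S0 step *; first by rewrite mul1r.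
have thk : k.+1%:R * theta < pi.
  by apply: le_lt_trans thN; rewrite ler_pM2r// ler_nat.
have {}IH : G 1%N * sin (k.+1%:R * theta) <= G k.+1 * sin theta.
  apply: IH => //.
  - by move=> j jk; apply: HG; exact: ltnW.
  - by move=> j /andP[j0 jk]; apply: S0; rewrite j0 ltnW.
  - by move=> j jk; apply: step; exact: ltnW.
have s1 : 0 < sin (k.+1%:R * theta) by apply: S0; rewrite /= ltnW.
have s2 : 0 < sin (k.+2%:R * theta) by apply: S0 => /=.
have s3 : 0 < sin theta by have := S0 1%N isT; rewrite mul1r.
have := step k.+1 (ltnSn _).
rewrite -(ler_pM2r s1) => h; rewrite -(ler_pM2r s1).
have := ler_wpM2r (ltW s2) IH.
have := ler_wpM2r (ltW s3) (step k.+1 (ltnSn _)).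
lra.
Qed.

(** * Compactness *)

Section Compactness.
Context {R : realType} (X : metricType R).
Local Notation dX := (@mdist R X).

Lemma sub_CAT (kappa : R) (A B : set X) : B `<=` A -> is_CAT kappa dX A -> is_CAT kappa dX B.
Proof.
move=> BA catA dk v g vg; refine (catA v g _) => i.
have [[l0 gB gE] g0 gl] := vg i; split=> //; split=> // s sl.
by apply: BA; exact: gB.
Qed.

(** A Lebesgue number for the cover of K by CAT balls. *)
Lemma uniform_CAT (kappa : R) (K : set X) : curvature_le X kappa -> compact K ->
  exists2 r, 0 < r & forall y, K y -> is_CAT kappa dX (ball y r).
Proof.
move=> curv /compact_near_coveringP cK.
have : \forall r \near (0 : R)^'+, K `<=` (fun y => is_CAT kappa dX (ball y r)).
  apply: cK => x _; have [r r0 cat] := curv x.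
  exists (ball x (r / 2), [set s | s < r / 2]) => /=.
    by split; [apply: nbhsx_ballx; lra|apply: nbhs_right_lt; lra].
  move=> [y s] /= [xy sr]; apply: sub_CAT cat => z yz.
  by rewrite (splitr r); apply: ball_triangle xy _; apply: le_ball yz; exact: ltW.
move=> h; near (0 : R)^'+ => r.
exists r; first by [].
by near: r.
Unshelve. all: by end_near.
Qed.

(** Stability of a unique geodesic: a point that is almost between x and z, at
    almost the right distances, is close to the point of the geodesic.  In the
    limit it would lie on a geodesic from x to z; properness makes the estimate
    uniform. *)
Lemma near_between (x y z : X) (e : R) : is_proper X -> is_geodesic_space X ->
  uniquely_joined x z -> dX x y + dX y z = dX x z -> 0 < e ->
  \forall eta \near (0 : R)^'+, forall y',
    dX x y' <= dX x y + eta -> dX y' z <= dX y z + eta -> dX y y' < e.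
Proof.
move=> hp hg uxz xyz e0.
have /compact_near_coveringP cK := hp x (dX x y + 1).
have h : \forall eta \near (0 : R)^'+, [set y' | dX x y' <= dX x y + 1] `<=`
    (fun y' => dX x y' <= dX x y + eta -> dX y' z <= dX y z + eta -> dX y y' < e).
  apply: cK => y1 _; have [<-|yy1] := eqVneq y y1.
    exists (ball y e, setT) => /=; first by split; [exact: nbhsx_ballx|exact: filterT].
    by move=> [y' s] /= []; rewrite ballEmdist.
  pose d1 := dX x y1 - dX x y; pose d2 := dX y1 z - dX y z.
  have d0 : 0 < d1 \/ 0 < d2.
    have [|le1] := ltP 0 d1; first by left.
    have [|le2] := ltP 0 d2; first by right.
    have tri1 := metric_triangle x y1 z.
    case/eqP: yy1; apply/esym/(between_unique hg uxz xyz); rewrite /d1 /d2 in le1 le2; lra.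
  pose d := Num.max d1 d2.
  have dgt : 0 < d by rewrite lt_max; apply/orP.
  exists (ball y1 (d / 2), [set s | s < d / 2]) => /=.
    by split; [apply: nbhsx_ballx; lra|apply: nbhs_right_lt; lra].
  move=> [y' s] /= []; rewrite ballEmdist /= => yy' sd h1 h2; exfalso.
  have := metric_triangle x y' y1; have := metric_triangle y1 y' z.
  rewrite (metric_sym y' y1).
  have : d = d1 \/ d = d2 by rewrite /d maxEle; case: ifP; [right|left].
  by rewrite /d1 /d2 in yy' sd *; case; lra.
near=> eta => y' h1 h2.
have : [set y' | dX x y' <= dX x y + 1] y'.
  by apply: le_trans h1 _; rewrite lerD2l; near: eta; exact: nbhs_right_le.
move=> /(near h eta); exact.
Unshelve. all: by end_near.
Qed.

End Compactness.

(** * Local geodesics *)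

(** The conclusion of the Sturm comparison is incompatible with y <= u <= x unless
    u vanishes, because sin(N theta) = sin(2 theta) > sin(theta). *)
Lemma chord_contraction_le0 (R : realType) (kappa theta u x y : R) (N : nat) :
  0 < theta < pi / 4 -> theta * N%:R + 2 * theta = pi ->
  u <= x -> 0 <= y -> y <= u -> Num.sqrt kappa * u <= pi -> Num.sqrt kappa * x <= pi ->
  chord kappa x * sin (N%:R * theta) <= chord kappa y * sin theta -> u <= 0.
Proof.
move=> /andP[th0 th1] thE ux y0 yu wu wx H; rewrite leNgt; apply/negP => u0.
have sinN : sin theta < sin (N%:R * theta).
  rewrite (_ : N%:R * theta = - (2 * theta) + pi); last lra.
  by rewrite sinDpi sinN opprK ltr_sin ?in_itv/=; lra.
have sN0 : 0 < sin theta by rewrite sin_gt0_pi//; lra.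
have cu := chord_gt0 u0 wu.
have c1 := ler_chord (ltW u0) ux wx.
have c2 := ler_chord y0 yu wu.
have sn0 : 0 <= sin (N%:R * theta) by lra.
have := ler_wpM2r sn0 c1; have := ler_wpM2r (ltW sN0) c2.
have : chord kappa u * sin theta < chord kappa u * sin (N%:R * theta).
  by rewrite ltr_pM2l.
lra.
Qed.

(** The number N of steps is chosen first: theta = pi / (N + 2) exceeds the angle
    w T / N of one step as soon as N (pi - w T) > 2 w T.  The excess then determines
    how far, namely e, the two curves may be apart. *)
Lemma grid_choice (R : realType) (w T b r : R) :
  0 <= w -> 0 < T -> 0 < b -> 0 < r -> w * T < pi ->
  exists (N : nat) (theta e : R),
    [/\ (4 <= N)%N, 0 < theta < pi / 4 & theta * N%:R + 2 * theta = pi] /\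
    [/\ 0 < e < T / N%:R, 4 * (T / N%:R) <= b, 16 * (T / N%:R) < r &
      w * (2 * (T / N%:R) + 3 * e) <= 2 * theta].
Proof.
move=> w0 T0 b0 r0 wT; have pi0 := pi_gt0 R.
have d0 : 0 < pi - w * T by rewrite subr_gt0.
have wT0 : 0 <= w * T by rewrite mulr_ge0// ltW.
have m1 : 0 <= 2 * (w * T) / (pi - w * T) by rewrite divr_ge0 ?mulr_ge0// ltW.
have m2 : 0 <= 4 * T / b by rewrite divr_ge0 ?mulr_ge0// ltW.
have m3 : 0 <= 16 * T / r by rewrite divr_ge0 ?mulr_ge0// ltW.
have [N MN] : exists N : nat,
    4 + 2 * (w * T) / (pi - w * T) + 4 * T / b + 16 * T / r < N%:R.
  by eexists; exact: truncnS_gt.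
have N4 : 4 <= N%:R :> R by lra.
have N0 : 0 < N%:R :> R by lra.
have h1 : 2 * (w * T) / (pi - w * T) < N%:R by lra.
have h2 : 4 * T / b < N%:R by lra.
have h3 : 16 * T / r < N%:R by lra.
rewrite ltr_pdivrMr// in h1; rewrite ltr_pdivrMr// in h2; rewrite ltr_pdivrMr// in h3.
pose theta : R := pi / (N%:R + 2).
have thE : theta * (N%:R + 2) = pi by rewrite /theta divfK//; lra.
have tau0 : 0 < T / N%:R by rewrite divr_gt0.
set tau := T / N%:R in tau0.
have tauE : tau * N%:R = T by rewrite /tau divfK//; lra.
have wth : w * tau < theta.
  rewrite -(ltr_pM2r N0) -mulrA tauE /theta mulrAC ltr_pdivlMr; lra.
have w1 : 0 < w + 1 by lra.
pose m : R := (theta - w * tau) / (2 * (w + 1)).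
have m0 : 0 < m by rewrite divr_gt0 ?subr_gt0// mulr_gt0.
have mE : (w + 1) * m = (theta - w * tau) / 2 by rewrite /m; field; lra.
pose e : R := Num.min m (tau / 2).
have e0 : 0 < e by rewrite lt_min m0 divr_gt0.
have em : e <= m by rewrite ge_min lexx.
have et : e <= tau / 2 by rewrite ge_min lexx orbT.
exists N, theta, e; rewrite -/tau; split; split.
- by rewrite -(ler_nat R).
- by apply/andP; split; rewrite /theta; [apply: divr_gt0 => //|rewrite ltr_pM2l// ltf_pV2 ?posrE]; lra.
- by rewrite -thE; ring.
- by rewrite e0 /=; lra.
- by rewrite -(ler_pM2r N0) -mulrA tauE; lra.
- by rewrite -(ltr_pM2r N0) -mulrA tauE; lra.
- have := ler_wpM2l (ltW w1) em; rewrite mE => h.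
  have : 0 <= w * e by rewrite mulr_ge0// ltW.
  by clear -h e0; lra.
Qed.

(** The step h differs from T / N by less than e, so that the bounds on T / N carry
    over to h. *)
Lemma grid_bounds (R : realType) (w T b r theta e F t : R) (N : nat) :
  (4 <= N)%N -> 0 <= w -> 0 < e -> e < T / N%:R -> 4 * (T / N%:R) <= b ->
  16 * (T / N%:R) < r -> w * (2 * (T / N%:R) + 3 * e) <= 2 * theta ->
  T - (t - T) <= F -> F <= t -> t - T <= e / 4 ->
  let h := F / N%:R in
  [/\ 0 < h, N%:R * h = F, e < 2 * h, h + e < r / 4 &
    [/\ 2 * h <= b, 2 * h + e <= T & w * (2 * h + e) <= 2 * theta]].
Proof.
move=> N4 w0 e0 eT Tb Tr Te FT Ft te h.
have NR : 4 <= N%:R :> R by rewrite ler_nat.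
have N0 : 0 < N%:R :> R by lra.
have hN : N%:R * h = F by rewrite /h mulrC divfK//; lra.
set tau := T / N%:R in eT Tb Tr Te.
have tauE : N%:R * tau = T by rewrite /tau mulrC divfK//; lra.
clearbody tau h.
have NE : 4 * (e / 4) <= N%:R * (e / 4) by rewrite ler_wpM2r// divr_ge0// ltW.
have NT : 4 * tau <= N%:R * tau by rewrite ler_wpM2r//; lra.
have h1 : h <= tau + e / 4.
  by rewrite -(ler_pM2l N0) mulrDr tauE hN; clear -NE Ft te e0; lra.
have h2 : tau - e / 4 <= h.
  by rewrite -(ler_pM2l N0) mulrBr tauE hN; clear -NE FT te e0; lra.
split; [lra|by []|lra|lra|split; [lra|lra|]].
by apply: le_trans Te; rewrite ler_wpM2l//; lra.
Qed.

Section LocallyCAT.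
Context {R : realType} (X : metricType R) (kappa : R).
Local Notation dX := (@mdist R X).
Local Notation w := (Num.sqrt kappa).
Hypothesis hproper : is_proper X.
Hypothesis hgeod : is_geodesic_space X.
Hypothesis hcurv : curvature_le X kappa.

(** The diagonal p q' cuts the quadrilateral into two triangles; the distance from
    m to m' is at most the sum of the distances from m to the midpoint n of the
    diagonal and from n to m'.  The diagonal may be as long as 2 h + e, whence the
    bound on theta. *)
Lemma CAT_quadrilateral (r theta h e : R) (p m q p' m' q' : X) :
  is_CAT kappa dX (ball m r) -> 0 < theta < pi / 4 ->
  w * (2 * h + e) <= 2 * theta -> h + e < r / 4 -> 0 <= e < 2 * h ->
  (forall x y, dX x y <= 2 * h + e -> uniquely_joined x y) ->
  dX p m = h -> dX m q = h -> dX p q = 2 * h ->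
  dX p' m' = h -> dX m' q' = h -> dX p' q' = 2 * h ->
  dX p p' <= e -> dX q q' <= e ->
  2 * cos theta * chord kappa (dX m m') <= chord kappa (dX p p') + chord kappa (dX q q').
Proof.
move=> cat th wth her /andP[e0 e2h] uniq pm mq pq p'm' m'q' p'q' pp' qq'.
have pq'le : dX p q' <= 2 * h + e.
  by have := metric_triangle p q q'; rewrite pq; lra.
have pq'ge : 2 * h - e <= dX p q'.
  by have := metric_triangle p q' q; rewrite pq (metric_sym q' q); lra.
have [n pn nq'] : exists2 n, dX p n = dX p q' / 2 & dX n q' = dX p q' / 2.
  have [g [[_ _ gE] g0 gl]] := hgeod p q'.
  have l0 : 0 <= dX p q' by exact: mdist_ge0.
  have e1 : dX (g 0) (g (dX p q' / 2)) = `|0 - dX p q' / 2| by rewrite gE //; lra.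
  have e2 : dX (g (dX p q' / 2)) (g (dX p q')) = `|dX p q' / 2 - dX p q'| by rewrite gE //; lra.
  exists (g (dX p q' / 2)).
    by rewrite -{1}g0 e1 sub0r normrN ger0_norm//; lra.
  by rewrite -{2}gl e2 distrC ger0_norm; lra.
have w0 := sqrtr_ge0 kappa.
have wh : 0 <= w * h by rewrite mulr_ge0//; lra.
have we : 0 <= w * e by rewrite mulr_ge0.
move: (wth); rewrite mulrDr => wth'.
have mp : dX m p = h by rewrite metric_sym.
have mq' : dX m q' <= h + e by have := metric_triangle m q q'; lra.
have mp' : dX m p' <= h + e by have := metric_triangle m p p'; lra.
have wpq' : w * dX p q' <= 2 * theta.
  by apply: le_trans wth; rewrite ler_wpM2l.
have wpq : w * (2 * h) <= 2 * theta.
  by apply: le_trans wth; rewrite ler_wpM2l//; lra.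
have hh : 2 * h / 2 = h by field.
have h0 : 0 < 2 * h by exact: le_lt_trans e2h.
have pq'0 : 0 < dX p q' by apply: lt_le_trans pq'ge; rewrite subr_gt0.
have mp_r : dX m p < r / 4 by apply: le_lt_trans her; rewrite mp lerDl.
have mq_r : dX m q < r / 4 by apply: le_lt_trans her; rewrite mq lerDl.
have mq'_r : dX m q' < r / 4 by exact: le_lt_trans her.
have mp'_r : dX m p' < r / 4 by exact: le_lt_trans her.
have c1 : 2 * cos theta * chord kappa (dX m n) <= chord kappa (dX q q').
  apply: (CAT_midpoints (p := p) hgeod cat); rewrite ?pq ?hh //.
  by apply: uniq; rewrite pq lerDl.
have q'pE : dX q' p = dX p q' by exact: metric_sym.
have q'p'E : dX q' p' = 2 * h by rewrite metric_sym.
have c2 : 2 * cos theta * chord kappa (dX n m') <= chord kappa (dX p p').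
  apply: (CAT_midpoints (p := q') hgeod cat) => //; rewrite ?q'pE ?q'p'E ?hh //.
  - by apply: uniq; rewrite q'pE.
  - by rewrite metric_sym.
  - by rewrite metric_sym.
  - by rewrite metric_sym.
  - by rewrite metric_sym.
have /andP[th0 th1] := th.
have ct : 0 <= cos theta by apply: cos_ge0_pihalf; lra.
have mo : dX m n <= 2 * h + e by have := metric_triangle m p n; lra.
have om' : dX n m' <= 2 * h + e.
  by have := metric_triangle n q' m'; rewrite (metric_sym q' m'); lra.
have wmo : w * dX m n <= 2 * theta by apply: le_trans wth; rewrite ler_wpM2l.
have wom' : w * dX n m' <= 2 * theta by apply: le_trans wth; rewrite ler_wpM2l.
have : chord kappa (dX m m') <= chord kappa (dX m n) + chord kappa (dX n m').
  apply: le_trans (chordD _ _ _ _); rewrite ?mdist_ge0//; try lra.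
  apply: ler_chord; [exact: mdist_ge0|exact: metric_triangle|].
  by rewrite mulrDr; lra.
have ct2 : 0 <= 2 * cos theta by rewrite mulr_ge0.
by move=> /(ler_wpM2l ct2); rewrite mulrDr; lra.
Qed.

Lemma grid_contraction (r theta h e : R) (N : nat) (a b : nat -> X) :
  (forall k, (k <= N)%N -> is_CAT kappa dX (ball (a k) r)) ->
  0 < theta < pi / 4 -> N%:R * theta < pi -> (0 < N)%N ->
  w * (2 * h + e) <= 2 * theta -> h + e < r / 4 -> 0 <= e < 2 * h ->
  (forall x y, dX x y <= 2 * h + e -> uniquely_joined x y) ->
  (forall k, (k < N)%N -> dX (a k) (a k.+1) = h) ->
  (forall k, (k.+1 < N)%N -> dX (a k) (a k.+2) = 2 * h) ->
  (forall k, (k < N)%N -> dX (b k) (b k.+1) = h) ->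
  (forall k, (k.+1 < N)%N -> dX (b k) (b k.+2) = 2 * h) ->
  a 0%N = b 0%N -> (forall k, (k <= N)%N -> dX (a k) (b k) <= e) ->
  chord kappa (dX (a 1%N) (b 1%N)) * sin (N%:R * theta) <=
    chord kappa (dX (a N) (b N)) * sin theta.
Proof.
move=> cat th thN N0 wh hr eh uniq a1 a2 b1 b2 ab0 ge.
have /andP[th0 _] := th.
apply: (@discrete_sturm _ theta N (fun k => chord kappa (dX (a k) (b k)))) => //.
  by rewrite ab0 mdistxx chord0.
move=> k kN; have kN1 := ltnW kN.
apply: (CAT_quadrilateral (cat _ kN1) th wh hr eh uniq); auto.
Qed.

Section LocalGeodesic.
Variables (gam : R -> X) (L b : R).
Hypothesis b0 : 0 < b.
Hypothesis wL : w * L < pi.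
Hypothesis uniq : forall x y : X, dX x y <= L -> uniquely_joined x y.
Hypothesis lip : forall s t : R, 0 <= s -> s <= t -> t <= L -> dX (gam s) (gam t) <= t - s.
Hypothesis loc : forall s t : R, 0 <= s -> s <= t -> t <= L -> t - s <= b ->
  dX (gam s) (gam t) = t - s.

Lemma lip_sym (s t : R) : 0 <= s <= L -> 0 <= t <= L -> dX (gam s) (gam t) <= `|s - t|.
Proof.
move=> /andP[s0 sL] /andP[t0 tL]; have [st|ts] := leP s t.
  by rewrite distrC ger0_norm ?subr_ge0// lip.
by rewrite metric_sym gtr0_norm ?subr_gt0// lip// ltW.
Qed.

Lemma initial_geodesic (T s : R) : 0 <= s <= T -> T <= L -> dX (gam 0) (gam T) = T ->
  dX (gam 0) (gam s) = s /\ dX (gam s) (gam T) = T - s.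
Proof.
move=> /andP[s0 sT] TL E.
have := lip (lexx 0) s0 (le_trans sT TL); have := lip s0 sT TL.
by have := metric_triangle (gam 0) (gam s) (gam T); rewrite E; lra.
Qed.

(** Points on a geodesic from gam t to gam 0 are almost between gam 0 and gam T;
    only finitely many fractions k / N of the length are considered, which makes
    eta uniform. *)
Lemma near_geodesic (T e : R) (N : nat) : 0 < T <= L -> dX (gam 0) (gam T) = T ->
  (0 < N)%N -> 0 < e ->
  exists2 eta : R, 0 < eta & forall (t : R) (y : X) (k : nat),
    T <= t <= T + eta -> t <= L -> (k <= N)%N ->
    let h := dX (gam 0) (gam t) / N%:R in
    dX (gam 0) y = dX (gam 0) (gam t) - k%:R * h -> dX y (gam t) = k%:R * h ->
    dX (gam (t - k%:R * h)) y <= e.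
Proof.
move=> /andP[T0 TL] ET N0 e0.
have NR : 0 < N%:R :> R by rewrite ltr0n.
pose c (k : nat) : R := k%:R / N%:R.
have c01 k : (k <= N)%N -> 0 <= c k <= 1.
  by move=> kN; rewrite divr_ge0//= ler_pdivrMr// mul1r ler_nat.
pose P (k : 'I_N.+1) (eta : R) := forall y',
  dX (gam 0) y' <= T - T * c k + eta -> dX y' (gam T) <= T * c k + eta ->
  dX (gam (T - T * c k)) y' < e / 2.
have : \forall eta \near (0 : R)^'+, forall k : 'I_N.+1, P k eta.
  apply: filter_forall => k; have ck := c01 k (ltn_ord k).
  have Tc : 0 <= T * c k <= T.
    have /andP[? ?] := ck; rewrite mulr_ge0 ?ler_piMr// ltW//.
  have [E1 E2] : dX (gam 0) (gam (T - T * c k)) = T - T * c k /\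
      dX (gam (T - T * c k)) (gam T) = T - (T - T * c k).
    by apply: initial_geodesic => //; lra.
  have := @near_between _ _ (gam 0) (gam (T - T * c k)) (gam T) (e / 2) hproper hgeod.
  rewrite E1 E2 ET (_ : T - (T - T * c k) = T * c k); last by ring.
  apply; [|lra|lra].
  by apply: uniq; rewrite ET.
move=> nearP.
pose Q (eta : R) := 0 < eta /\ (forall k : 'I_N.+1, P k eta).
have [eta0 [eta00 HP]] : exists eta, Q eta.
  near (0 : R)^'+ => eta; exists eta; split => //; near: eta; exact: nearP.
(* A point y at distance k h from gam t is within k h + (t - T) of gam T, and k h
   itself exceeds T k / N by t - T at most: hence the factor 1 / 2. *)
exists (Num.min (eta0 / 2) (e / 4)); first by rewrite lt_min !divr_gt0.
move=> t y k /andP[Tt]; rewrite -lerBlDl le_min => /andP[te te'] tL kN h xy yt.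
have ck := c01 k kN; have /andP[ck0 ck1] := ck.
have t0 : 0 < t by lra.
set F := dX (gam 0) (gam t) in h xy yt *.
have kh : k%:R * h = F * c k by rewrite /h /c mulrCA.
rewrite kh in xy yt *.
have Ft : F <= t by have := lip (lexx 0) (ltW t0) tL; rewrite subr0.
have tT : dX (gam T) (gam t) <= t - T by apply: lip => //; exact: ltW.
have FT : T - (t - T) <= F.
  have := metric_triangle (gam 0) (gam t) (gam T); rewrite ET.
  by rewrite (metric_sym (gam t)) -/F; lra.
have h1 : (F - T) * c k <= t - T.
  apply: le_trans (_ : (t - T) * c k <= _); first by rewrite ler_wpM2r//; lra.
  by rewrite ler_piMr//; lra.
have h2 : - (t - T) <= (F - T) * c k.
  apply: le_trans (_ : - (t - T) * c k <= _); last by rewrite ler_wpM2r//; lra.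
  by rewrite mulNr lerN2 ler_piMr//; lra.
have h3 : (F - T) * (1 - c k) <= t - T.
  apply: le_trans (_ : (t - T) * (1 - c k) <= _); first by rewrite ler_wpM2r//; lra.
  by rewrite ler_piMr//; lra.
have Tc : 0 <= T * c k <= T by rewrite mulr_ge0 ?ler_piMr// ltW.
have F0 : 0 <= F by exact: mdist_ge0.
have Fc : 0 <= F * c k <= F by rewrite mulr_ge0 ?ler_piMr// ltW.
have near_y : dX (gam (T - T * c k)) y < e / 2.
  apply: (HP (Ordinal (_ : k < N.+1)%N)) => /=; rewrite ?ltnS//.
    by rewrite xy; lra.
  have := metric_triangle y (gam t) (gam T); rewrite yt (metric_sym (gam t)); lra.
have near_g : dX (gam (t - F * c k)) (gam (T - T * c k)) <= 2 * (t - T).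
  apply: le_trans (lip_sym _ _) _; [lra|lra|].
  by rewrite ler_norml; lra.
have := metric_triangle (gam (t - F * c k)) (gam (T - T * c k)) y; lra.
Unshelve. all: by end_near.
Qed.

(** With F = d(gam 0, gam t), both sequences below start at gam t: al runs back
    along gam and bt along a geodesic to gam 0.  The defect t - F is at least the
    distance of their last points and at most that of their first points, which
    the contraction of [grid_contraction] allows only if it is zero. *)
Lemma extend_geodesic (T : R) : 0 < T <= L -> dX (gam 0) (gam T) = T ->
  exists2 eta : R, 0 < eta & forall t : R, T <= t <= T + eta -> t <= L ->
    dX (gam 0) (gam t) = t.
Proof.
move=> TL0 ET; have /andP[T0 TL] := TL0.
have [r r0 cat] := uniform_CAT hcurv (@hproper (gam 0) L).
have w0 : 0 <= w := sqrtr_ge0 kappa.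
have wT : w * T < pi by apply: le_lt_trans wL; rewrite ler_wpM2l.
have [N [theta [e [[N4 th thE] [/andP[e0 eT] Tb Tr Te]]]]] := grid_choice w0 T0 b0 r0 wT.
have N0 : (0 < N)%N by exact: leq_trans N4.
have [eta eta0 near] := near_geodesic TL0 ET N0 e0.
exists (Num.min eta (e / 4)); first by rewrite lt_min eta0 divr_gt0.
move=> t /andP[Tt]; rewrite -lerBlDl le_min => /andP[te te'] tL.
have t0 : 0 <= t by exact: le_trans (ltW T0) Tt.
have Ft : dX (gam 0) (gam t) <= t by have := lip (lexx 0) t0 tL; rewrite subr0.
have tT : dX (gam T) (gam t) <= t - T by apply: lip => //; exact: ltW.
have FT : T - (t - T) <= dX (gam 0) (gam t).
  have := metric_triangle (gam 0) (gam t) (gam T).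
  by rewrite ET (metric_sym (gam t)); move: tT; lra.
have [be [[_ _ beE] be0 beF]] := hgeod (gam t) (gam 0).
have FE : dX (gam t) (gam 0) = dX (gam 0) (gam t) by exact: metric_sym.
have [h0 hN eh hr [hb hL wh]] := grid_bounds N4 w0 e0 eT Tb Tr Te FT Ft te'.
rewrite FE in beE beF.
set F := dX (gam 0) (gam t) in Ft FT beE beF h0 hN eh hr hb hL wh *.
set h := F / N%:R in h0 hN eh hr hb hL wh.
pose al (k : nat) := gam (t - k%:R * h).
pose bt (k : nat) := be (k%:R * h).
have kF k : (k <= N)%N -> 0 <= k%:R * h <= F.
  by move=> kN; rewrite mulr_ge0 ?(ltW h0)//= -hN ler_pM2r// ler_nat.
have k1 k : k.+1%:R * h = k%:R * h + h by rewrite -natr1 mulrDl mul1r.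
have k2 k : k.+2%:R * h = k%:R * h + 2 * h by rewrite !k1; ring.
have btd i j : (i <= j <= N)%N -> dX (bt i) (bt j) = j%:R * h - i%:R * h.
  move=> /andP[ij jN]; rewrite beE ?kF//; last exact: leq_trans jN.
  by rewrite distrC ger0_norm// subr_ge0 ler_pM2r// ler_nat.
have ald i j : (i <= j <= N)%N -> j%:R * h - i%:R * h <= b ->
    dX (al i) (al j) = j%:R * h - i%:R * h.
  move=> /andP[ij jN] hbb; have /andP[_ jF] := kF j jN.
  have /andP[i0 _] := kF i (leq_trans ij jN).
  have ijh : i%:R * h <= j%:R * h by rewrite ler_pM2r// ler_nat.
  have jt : j%:R * h <= t by exact: le_trans Ft.
  have tij : t - i%:R * h - (t - j%:R * h) = j%:R * h - i%:R * h by ring.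
  rewrite metric_sym /al loc ?tij ?subr_ge0 ?lerB//.
  by apply: le_trans tL; rewrite gerBl.
have bt0 : bt 0%N = gam t by rewrite /bt mul0r.
have btN : bt N = gam 0 by rewrite /bt hN.
have ge k : (k <= N)%N -> dX (al k) (bt k) <= e.
  move=> kN.
  have E1 : dX (bt k) (bt N) = N%:R * h - k%:R * h by rewrite btd// kN leqnn.
  have E2 : dX (bt 0%N) (bt k) = k%:R * h - 0%:R * h by rewrite btd.
  rewrite btN hN metric_sym in E1; rewrite bt0 mul0r subr0 metric_sym in E2.
  by apply: near => //; rewrite Tt -lerBlDl.
have hb1 : h <= b by lra.
have sturm : chord kappa (dX (al 1%N) (bt 1%N)) * sin (N%:R * theta) <=
    chord kappa (dX (al N) (bt N)) * sin theta.
  apply: (@grid_contraction r theta h e).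
  - move=> k kN; apply: cat; have /andP[k0 kF'] := kF k kN => /=.
    have kt : k%:R * h <= t by exact: le_trans Ft.
    apply: le_trans (lip (lexx _) _ _) _; rewrite ?subr_ge0 ?subr0//.
      by apply: le_trans tL; rewrite gerBl.
    by apply: le_trans tL; rewrite gerBl.
  - by [].
  - by move: th thE => /andP[th0 _]; lra.
  - by [].
  - by [].
  - by [].
  - by rewrite ltW.
  - by move=> x y xy; apply: uniq; apply: le_trans xy _; exact: le_trans TL.
  - have D k : k.+1%:R * h - k%:R * h = h by rewrite k1 addrAC subrr add0r.
    by move=> k kN; rewrite ald ?leqnSn ?kN// D.
  - have D k : k.+2%:R * h - k%:R * h = 2 * h by rewrite k2 addrAC subrr add0r.
    by move=> k kN; rewrite ald ?leqW ?leqnSn// D.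
  - by move=> k kN; rewrite btd ?leqnSn ?kN// k1 addrAC subrr add0r.
  - by move=> k kN; rewrite btd ?leqW ?leqnSn// k2 addrAC subrr add0r.
  - by rewrite bt0 /al mul0r subr0.
  - exact: ge.
have hF : h <= F by have := kF 1%N N0; rewrite mul1r => /andP[].
have tT' : t - T <= h by lra.
have ug : t - F <= dX (al 1%N) (bt 1%N).
  have th0 : 0 <= t - h by rewrite subr_ge0; exact: le_trans Ft.
  have [E _] : dX (gam 0) (gam (t - h)) = t - h /\ dX (gam (t - h)) (gam T) = T - (t - h).
    by apply: initial_geodesic => //; rewrite th0 lerBlDr -lerBlDl.
  have := metric_triangle (gam (t - h)) (bt 1%N) (bt N).
  rewrite btd ?N0 ?leqnn//= btN hN mul1r [dX _ (gam 0)]metric_sym E.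
  by rewrite /al mul1r; lra.
have gu : dX (al N) (bt N) <= t - F.
  rewrite btN /al hN metric_sym; apply: le_trans (lip (lexx _) _ _) _; rewrite ?subr_ge0 ?subr0//.
  by apply: le_trans tL; rewrite gerBl mdist_ge0.
have wu : w * (t - F) <= pi.
  apply: ltW; apply: le_lt_trans wL; rewrite ler_wpM2l//.
  by apply: le_trans tL; rewrite gerBl mdist_ge0.
have wg : w * dX (al 1%N) (bt 1%N) <= pi.
  have h1 : w * dX (al 1%N) (bt 1%N) <= w * (2 * h + e).
    by rewrite ler_wpM2l// (le_trans (ge 1%N N0))// lerDr mulr_ge0// ltW.
  move: th => /andP[th0 th1]; lra.
apply/eqP; rewrite eq_le Ft /= -subr_le0.
exact: (chord_contraction_le0 th thE ug (mdist_ge0 _ _) gu wu wg sturm).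
Qed.

End LocalGeodesic.

(** The times t for which d(gam 0, gam t) = t form a closed set, which contains
    more than 0 and whose supremum can be pushed forward as long as it is smaller
    than L. *)
Lemma local_geodesic_geodesic (gam : R -> X) (L b : R) :
  0 < b -> 0 < L -> w * L < pi -> (forall x y : X, dX x y <= L -> uniquely_joined x y) ->
  (forall s t : R, 0 <= s -> s <= t -> t <= L -> dX (gam s) (gam t) <= t - s) ->
  (forall s t : R, 0 <= s -> s <= t -> t <= L -> t - s <= b ->
    dX (gam s) (gam t) = t - s) ->
  dX (gam 0) (gam L) = L.
Proof.
move=> b0 L0 wL uniq lip loc.
pose E := [set t : R | 0 <= t <= L /\ dX (gam 0) (gam t) = t].
have E0 : E (Num.min b L).
  have m0 : 0 <= Num.min b L by rewrite le_min !ltW.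
  have mL : Num.min b L <= L by rewrite ge_min lexx orbT.
  split; first by rewrite m0 mL.
  by rewrite loc// ?subr0// ge_min lexx.
have supE : has_sup E by split; [exists (Num.min b L)|exists L => t [/andP[]]].
set T := sup E.
have T0 : 0 < T.
  apply: lt_le_trans (_ : Num.min b L <= _); first by rewrite lt_min b0.
  exact: sup_upper_bound.
have TL : T <= L by apply: ge_sup; [exists (Num.min b L)|move=> t [/andP[]]].
have ET : dX (gam 0) (gam T) = T.
  apply/eqP; rewrite eq_le; have := lip 0 T (lexx _) (ltW T0) TL.
  rewrite subr0 => -> /=; rewrite leNgt; apply/negP => lt.
  have d0 : 0 < (T - dX (gam 0) (gam T)) / 2 by rewrite divr_gt0 ?subr_gt0.
  have [t [/andP[t0 tL] Et] tT] := sup_adherent d0 supE.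
  have tT' : t <= T by apply: sup_upper_bound => //; split=> //; rewrite t0.
  have := lip t T t0 tT' TL; have := metric_triangle (gam 0) (gam T) (gam t).
  rewrite Et (metric_sym (gam T)); move: tT; rewrite -/T; lra.
move: TL; rewrite le_eqVlt => /predU1P[<-//|TltL].
have T0L : 0 < T <= L by rewrite T0 ltW.
have [eta eta0 ext] := extend_geodesic b0 wL uniq lip loc T0L ET.
pose t := Num.min (T + eta) L.
have tL : t <= L by rewrite ge_min lexx orbT.
have Tt : T < t by rewrite lt_min TltL ltrDl eta0.
have : E t.
  split; first by rewrite tL (ltW (lt_trans T0 Tt)).
  by apply: ext => //; rewrite (ltW Tt) ge_min lexx.
by move=> /(sup_upper_bound supE); rewrite leNgt Tt.
Qed.

Lemma glue_geodesics (x0 x1 x2 x3 : X) :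
  dX x0 x2 = dX x0 x1 + dX x1 x2 -> dX x1 x3 = dX x1 x2 + dX x2 x3 ->
  uniquely_joined x0 x2 -> uniquely_joined x1 x3 -> uniquely_joined x1 x2 ->
  let L := length4 x0 x1 x2 x3 in
  exists gam : R -> X, [/\ gam 0 = x0, gam L = x3,
    forall s t, 0 <= s -> s <= t -> t <= L -> dX (gam s) (gam t) <= t - s &
    forall s t, 0 <= s -> s <= t -> t <= L -> t - s <= dX x1 x2 ->
      dX (gam s) (gam t) = t - s].
Proof.
move=> e02 e13 u02 u13 u12 L; rewrite /L /length4 => {L}.
have [g G ga] := geodesic_through hgeod (esym e02).
have [h H hb] := geodesic_through hgeod (esym e13).
have [[_ _ gE] g0 gl] := G; have [[_ _ hE] h0 hl] := H.
move: e02 e13 ga hb gE gl hE hl.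
have := mdist_ge0 x0 x1; have := mdist_ge0 x1 x2; have := mdist_ge0 x2 x3.
set a := dX x0 x1; set b := dX x1 x2; set c := dX x2 x3.
move=> c0 b0 a0 e02 e13 ga hb gE gl hE hl.
rewrite e02 in gE gl; rewrite e13 in hE hl.
pose gam (s : R) := if s <= a + b then g s else h (s - a).
  (* Both geodesics run through x1 and x2, which are joined uniquely. *)
have agree s : a <= s -> s <= a + b -> g s = h (s - a).
  move=> as_ sab.
  have e1 : dX x1 (g s) = s - a.
    by rewrite -ga gE; [rewrite distrC ger0_norm ?subr_ge0|lra|lra].
  have e2 : dX (g s) x2 = a + b - s.
    by rewrite -{1}gl gE; [rewrite distrC ger0_norm ?subr_ge0|lra|lra].
  have e3 : dX x1 (h (s - a)) = s - a.
    by rewrite -h0 hE; [rewrite sub0r normrN ger0_norm ?subr_ge0|lra|lra].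
  have e4 : dX (h (s - a)) x2 = a + b - s.
    rewrite -{1}hb hE; [rewrite distrC ger0_norm; lra|lra|lra].
  apply: (between_unique hgeod u12); rewrite ?e1 ?e2 ?e3 ?e4 -/b //; lra.
have gam1 (s : R) : s <= a + b -> gam s = g s by rewrite /gam => ->.
have gam2 s : a <= s -> gam s = h (s - a).
  by move=> as_; rewrite /gam; case: ifP => // /(agree _ as_).
have d1 (s t : R) : 0 <= s -> s <= t -> t <= a + b -> dX (gam s) (gam t) = t - s.
  move=> s0 st tab; rewrite !gam1 ?gE//; try lra.
  by rewrite distrC ger0_norm ?subr_ge0.
have d2 s t : a <= s -> s <= t -> t <= a + b + c -> dX (gam s) (gam t) = t - s.
  move=> as_ st tab; rewrite !gam2 ?hE//; try lra.
  by rewrite distrC ger0_norm; lra.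
exists gam; split.
- by rewrite gam1 ?g0 ?addr_ge0.
- by rewrite gam2; [rewrite (_ : a + b + c - a = b + c)//; ring|lra].
- move=> s t s0 st tL; have [tab|tab] := leP t (a + b); first by rewrite d1.
  have [as_|sa] := leP a s; first by rewrite d2.
  apply: le_trans (metric_triangle _ (gam a) _) _.
  by rewrite d1 ?d2; lra.
- move=> s t s0 st tL tsb; have [tab|tab] := leP t (a + b); first by rewrite d1.
  by rewrite d2//; lra.
Qed.

End LocallyCAT.

Theorem proposition6p4 (R : realType) (kappa : R) (X : metricType R)
  (hproper : is_proper X) (hgeod : is_geodesic_space X)
  (hcurv : curvature_le X kappa)
  (hinj : (injectivity_radius X <= diameter_bound kappa)%E) :
  (injectivity_radius X <= min_cut_length X)%E.
Proof.
apply: le_ereal_inf_tmp => _ [x0 [x1 [x2 [x3 [[[n01 n12 n23] e02 e13 short] ->]]]]].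
rewrite leNgt; apply/negP => Llt.
move: short; set L := length4 x0 x1 x2 x3 in Llt *.
have [_ [r [r0 ru] <-]] := ereal_sup_gt Llt; rewrite lte_fin => Lr.
have uniq (x y : X) : mdist x y <= L -> uniquely_joined x y.
  by move=> xy; exact: (ru _ _ (le_lt_trans xy Lr)).
have b0 : 0 < mdist x1 x2 by rewrite mdist_gt0; apply/eqP.
have a0 := mdist_ge0 x0 x1; have c0 := mdist_ge0 x2 x3.
have LE : L = mdist x0 x1 + mdist x1 x2 + mdist x2 x3 by [].
have wL : Num.sqrt kappa * L < pi.
  have := lt_le_trans Llt hinj; rewrite /diameter_bound; case: ifPn => k0.
    by rewrite lte_fin ltr_pdivlMr ?sqrtr_gt0// mulrC.
  by rewrite ler0_sqrtr ?mul0r ?pi_gt0// leNgt.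
have [|||gam [gam0 gamL lip loc]] := glue_geodesics hgeod e02 e13.
- by apply: uniq; rewrite e02; lra.
- by apply: uniq; rewrite e13; lra.
- by apply: uniq; lra.
have := local_geodesic_geodesic hproper hgeod hcurv b0 _ wL uniq lip loc.
by rewrite gam0 gamL => ->; [rewrite ltxx|lra].
Qed.
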